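(* Let $(Y,\mathbf{X})$ and $(Y',\mathbf{X}')$ be random vectors with $Y,Y'$ real-valued and $\mathbf{X},\mathbf{X}'$ taking values in $\mathbb{R}^p$, $\mathbb{R}^{p'}$, $p,p'\in\mathbb{N}$. Let $U,V\sim U(0,1)$ be independent. The following statements are equivalent: (i) $(Y,\mathbf{X})\preccurlyeq_{ccx}(Y',\mathbf{X}')$; (ii) $(F_Y\circ F_{Y|\mathbf{X}}^{-1}(V),V)\ge_c(F_{Y'}\circ F_{Y'|\mathbf{X}'}^{-1}(V),V)$ with $V$ independent of $\mathbf{X}$ and $\mathbf{X}'$; (iii) $(F_Y\circ q_{Y;\mathbf{X}}^{\uparrow U}(V),U)\le_c(F_{Y'}\circ q_{Y';\mathbf{X}'}^{\uparrow U}(V),U)$. In particular, $(Y,\mathbf{X})=_{ccx}(Y',\mathbf{X}')$ if and only if $(F_Y\circ F_{Y|\mathbf{X}}^{-1}(V),V)\stackrel{d}{=}(F_{Y'}\circ F_{Y'|\mathbf{X}'}^{-1}(V),V)$ if and only if $(F_Y\circ q_{Y;\mathbf{X}}^{\uparrow U}(V),U)\stackrel{d}{=}(F_{Y'}\circ q_{Y';\mathbf{X}'}^{\uparrow U}(V),U)$.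
   Context: $F_Y$ is the distribution function of $Y$; for a distribution function $G$, $G^{-1}(v)=\inf\{y\mid G(y)\ge v\}$, $v\in(0,1)$; $q_Y=F_Y^{-1}$. $F_{Y|\mathbf{X}=\mathbf{x}}$ is the conditional distribution function of $Y$ given $\mathbf{X}=\mathbf{x}$ (from a regular conditional distribution), and $F_{Y|\mathbf{X}}^{-1}(V)$ is the random variable $F_{Y|\mathbf{X}=\mathbf{x}}^{-1}(V)$ evaluated at $\mathbf{x}=\mathbf{X}$. $\stackrel{d}{=}$ is equality in distribution. Convex order of bounded random variables: $S\le_{cx}T$ iff $\mathbb{E}\varphi(S)\le\mathbb{E}\varphi(T)$ for all convex $\varphi\colon\mathbb{R}\to\mathbb{R}$. Conditional convex order: $(Y,\mathbf{X})\preccurlyeq_{ccx}(Y',\mathbf{X}')$ iff $P(Y\ge q_Y(v)\mid\mathbf{X})\le_{cx}P(Y'\ge q_{Y'}(v)\mid\mathbf{X}')$ for all $v\in(0,1)$; $=_{ccx}$ means both directions hold. Concordance order of bivariate random vectors: $(S,T)\le_c(S',T')$ iff $P(S\le s,T\le t)\le P(S'\le s,T'\le t)$ and $P(S>s,T>t)\le P(S'>s,T'>t)$ for all $s,t\in\mathbb{R}$; $\ge_c$ is the reverse relation. Rearranged quantile transform: The multivariate quantile transform $\mathbf{q}_{\mathbf{X}}\colon(0,1)^p\to\mathbb{R}^p$ is $\mathbf{q}_{\mathbf{X}}(\mathbf{u})=(x_1,\ldots,x_p)$ with $x_1=F_{X_1}^{-1}(u_1)$ and iteratively $x_i=F^{-1}_{X_i|X_{i-1}=x_{i-1},\ldots,X_1=x_1}(u_i)$;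 thus $\mathbf{q}_{\mathbf{X}}(\mathbf{U})\stackrel{d}{=}\mathbf{X}$ for $\mathbf{U}$ uniform on $(0,1)^p$. The decreasing rearrangement of an integrable $h\colon(0,1)^k\to\mathbb{R}$ is the ($\lambda$-essentially unique) decreasing function $h^*\colon(0,1)\to\mathbb{R}$ with $\lambda(h^*\ge w)=\lambda^k(h\ge w)$ for all $w\in\mathbb{R}$ ($\lambda^k$ Lebesgue measure). Let $(y,u)\mapsto F_u(y)$ be such that for every $y\in\mathbb{R}$ the map $u\mapsto F_u(y)$ is a decreasing rearrangement of $\mathbf{u}\mapsto P(Y\le y\mid\mathbf{X}=\mathbf{q}_{\mathbf{X}}(\mathbf{u}))$ and for every $u\in(0,1)$ the map $y\mapsto F_u(y)$ is a distribution function (such a version exists). Then $q_{Y;\mathbf{X}}^{\uparrow u}(t):=F_u^{-1}(t)$, $t\in(0,1)$. The same construction applied to $(Y',\mathbf{X}')$ gives $q_{Y';\mathbf{X}'}^{\uparrow u}$. *)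

(* Defs.v *)
From HB Require Import structures.
From mathcomp Require Import all_boot all_order all_algebra.
From mathcomp Require Import all_classical all_reals all_analysis.

Set Implicit Arguments.
Unset Strict Implicit.
Unset Printing Implicit Defensive.

Import Order.TTheory GRing.Theory Num.Theory.
Import numFieldNormedType.Exports.

Local Open Scope classical_set_scope.
Local Open Scope ring_scope.

(* Generalized inverse inf {y | G y >= v} for v in (0,1).  Outside its domain
   (0,1) it takes the arbitrary value 0. *)
Definition quantile (R : realType) (G : R -> R) (v : R) : R :=
  if 0 < v < 1 then inf [set y | v <= G y] else 0.

Definition is_cdf (R : realType) (G : R -> R) : Prop :=
  [/\ {homo G : x y / x <= y}, right_continuous G,
      G x @[x --> -oo] --> (0 : R) & G x @[x --> +oo] --> (1 : R)].

Definition df d (T : measurableType d) (R : realType) (P : probability T R)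
  (Y : {RV P >-> R}) (y : R) : R := fine (cdf Y y).

Definition regular_cond_distribution d (T : measurableType d)
    d1 (T1 : measurableType d1) d2 (T2 : measurableType d2) (R : realType)
    (P : probability T R) (Y : T -> T2) (X : T -> T1)
    (K : R.-pker T1 ~> T2) : Prop :=
  forall (A : set T1) (B : set T2), measurable A -> measurable B ->
    P (X @^-1` A `&` Y @^-1` B) = (\int[P]_(w in X @^-1` A) K (X w) B)%E.

Definition cond_df d1 (T1 : measurableType d1) (R : realType)
  (K : R.-pker T1 ~> R) (x : T1) (y : R) : R := fine (K x `]-oo, y]%classic).

Definition convex_order d (T : measurableType d) (R : realType)
    (P : probability T R) (S S' : T -> R) : Prop :=
  forall phi : R -> R, convex_function (E := R^o) [set: R] phi ->
    ('E_P[phi \o S] <= 'E_P[phi \o S'])%E.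

(* P(Y >= q | X), computed from the regular conditional distribution K. *)
Definition cond_survival d (T : measurableType d) d1 (T1 : measurableType d1)
  (R : realType) (K : R.-pker T1 ~> R) (X : T -> T1) (q : R) (w : T) : R :=
  fine (K (X w) `[q, +oo[%classic).

Definition ccx_le d (T : measurableType d) (R : realType)
    (P : probability T R) d1 (T1 : measurableType d1)
    d2 (T2 : measurableType d2)
    (Y : {RV P >-> R}) (X : T -> T1) (K : R.-pker T1 ~> R)
    (Y' : {RV P >-> R}) (X' : T -> T2) (K' : R.-pker T2 ~> R) : Prop :=
  forall v : R, 0 < v < 1 ->
    convex_order P (cond_survival K X (quantile (df Y) v))
                   (cond_survival K' X' (quantile (df Y') v)).

Definition ccx_eq d (T : measurableType d) (R : realType)
    (P : probability T R) d1 (T1 : measurableType d1)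
    d2 (T2 : measurableType d2)
    (Y : {RV P >-> R}) (X : T -> T1) (K : R.-pker T1 ~> R)
    (Y' : {RV P >-> R}) (X' : T -> T2) (K' : R.-pker T2 ~> R) : Prop :=
  ccx_le Y X K Y' X' K' /\ ccx_le Y' X' K' Y X K.

Definition concordance_le d (T : measurableType d) (R : realType)
    (P : probability T R) (Z Z' : T -> R * R) : Prop :=
  forall s t : R,
    (P [set w | (Z w).1 <= s /\ (Z w).2 <= t]%R <=
     P [set w | (Z' w).1 <= s /\ (Z' w).2 <= t]%R)%E /\
    (P [set w | (Z w).1 > s /\ (Z w).2 > t]%R <=
     P [set w | (Z' w).1 > s /\ (Z' w).2 > t]%R)%E.

Definition eq_distribution d (T : measurableType d)
    d1 (T1 : measurableType d1) (R : realType)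
    (P : probability T R) (Z Z' : T -> T1) : Prop :=
  forall A : set T1, measurable A -> P (Z @^-1` A) = P (Z' @^-1` A).

Definition independent_rv d (T : measurableType d) (R : realType)
    (P : probability T R) d1 (T1 : measurableType d1)
    d2 (T2 : measurableType d2) (X : T -> T1) (Y : T -> T2) : Prop :=
  forall (A : set T1) (B : set T2), measurable A -> measurable B ->
    P (X @^-1` A `&` Y @^-1` B) = (P (X @^-1` A) * P (Y @^-1` B))%E.

Definition uniform01 d (T : measurableType d) (R : realType)
    (P : probability T R) (V : {RV P >-> R}) : Prop :=
  forall A : set R, measurable A ->
    distribution P V A = uniform_prob (@ltr01 R) A.

(* k-dimensional Lebesgue measure, as an iterated product measure. *)
Fixpoint lebesgue_tuple (R : realType) (k : nat) : set (k.-tuple R) -> \bar R :=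
  match k with
  | 0%N => \d_[tuple]
  | k'.+1 => pushforward (@lebesgue_measure R \x lebesgue_tuple (k := k'))%E
               (fun z => [tuple of z.1 :: z.2])
  end.

Definition open_cube (R : realType) (k : nat) : set (k.-tuple R) :=
  [set u | forall i, 0 < tnth u i < 1].

(* The first i coordinates of x, for i <= p. *)
Definition first_coords (R : realType) (p : nat) (i : nat) (x : p.-tuple R) :
  i.-tuple R := [tuple x`_j | j < i].

(* With coordinates numbered from 0, Q i is a regular conditional distribution
   of X_i given (X_0, ..., X_(i-1)); for i = 0 the conditioning is on the
   constant empty tuple, hence Q 0 [tuple] is the law of X_0.  The Q i with
   i >= p are irrelevant. *)
Definition sequential_cond_distributions d (T : measurableType d)
    (R : realType) (P : probability T R) (p : nat) (X : T -> p.-tuple R)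
    (Q : forall i : nat, R.-pker (i.-tuple R) ~> R) : Prop :=
  forall i : nat, (i < p)%N ->
    regular_cond_distribution P (fun w => (X w)`_i)
      (fun w => first_coords i (X w)) (Q i).

Fixpoint quantile_transform (R : realType)
    (Q : forall i : nat, R.-pker (i.-tuple R) ~> R) (u : seq R) (k : nat) :
    k.-tuple R :=
  match k with
  | 0%N => [tuple]
  | i.+1 => let x := quantile_transform Q u i in
            [tuple of rcons x (quantile (cond_df (Q i) x) u`_i)]
  end.

Definition decreasing_rearrangement (R : realType) (k : nat)
    (h : k.-tuple R -> R) (g : R -> R) : Prop :=
  {in `]0, 1[ &, {homo g : u v /~ u <= v}} /\
  forall w : R,
    lebesgue_measure (`]0, 1[%classic `&` [set u | w <= g u]) =
    lebesgue_tuple (@open_cube R k `&` [set u | w <= h u]).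

(* F u y is the map (y, u) |-> F_u(y) of the rearranged quantile transform;
   only u in (0,1) matters. *)
Definition rearranged_cond_df (R : realType) (p : nat)
    (K : R.-pker (p.-tuple R) ~> R)
    (Q : forall i : nat, R.-pker (i.-tuple R) ~> R) (F : R -> R -> R) : Prop :=
  (forall y : R, decreasing_rearrangement
     (fun u : p.-tuple R => cond_df K (quantile_transform Q u p) y)
     (fun u : R => F u y)) /\
  (forall u : R, 0 < u < 1 -> is_cdf (F u)).

(* Arbitrary value 0 for u outside (0,1), where F u is unconstrained. *)
Definition rearranged_quantile (R : realType) (F : R -> R -> R) (u t : R) : R :=
  if 0 < u < 1 then quantile (F u) t else 0.

(* Main.v *)
(* Fix v in (0,1) and q = q_Y(v), and let S = P(Y >= q | X).  Since
   F_Y(y) >= v iff y >= q, the events defining the two concordance orders only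
   involve conditional quantiles:
     P(F_Y(F_{Y|X}^{-1}(V)) >= v, V > t) = E min(S, 1 - t)
                                         = E S - E (S - (1 - t))^+,
     P(F_Y(q^{up U}(V)) >= v, U > t)     = E [g(U) 1_{U > t}],
   where g = 1 - F_u(q-) is increasing and g(U) has the law of S, because the
   quantile transform of a uniform vector has the law of X.  The convex order of
   two [0,1]-valued variables amounts to equal means and ordered stop-loss
   transforms E (S - c)^+, which settles the first equivalence; the second one
   is the Legendre duality between c |-> E (g(U) - c)^+ and
   t |-> E [g(U) 1_{U > t}].  Equality in distribution is concordance in both
   directions. *)

Require Import Defs.
From HB Require Import structures.
From mathcomp Require Import all_boot all_order all_algebra.
From mathcomp Require Import all_classical all_reals all_analysis.
From mathcomp Require Import measurable_realfun ring lra.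

Import Order.TTheory GRing.Theory Num.Theory.
Import numFieldNormedType.Exports.

Local Open Scope classical_set_scope.
Local Open Scope ring_scope.

Set Implicit Arguments.
Unset Strict Implicit.
Unset Printing Implicit Defensive.

(** * Uniqueness of measures and disintegration *)

(** The concordance order compares both orthants, while the two formulas above concern only the
    upper one. The vectors compared share a uniform second coordinate, so the upper orthant at level
    0 and the lower orthant at level 1 compare their first margins in opposite directions. The
    margins therefore agree, and this is where equality of means comes from; once they agree, the
    inequality on either orthant implies the other. Monotonicity, rearrangement and the inversion of
    distribution functions are available only on (0,1), and often only up to one boundary point.
    Events are therefore compared modulo null sets of a uniform variable. The rearrangement is
    prescribed separately for each y, through closed superlevel sets. The law at q- is reached along
    the points q - 1/(n+1), by continuity from below. Stop-loss transforms control all convex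
    functions because, on [0,1], the piecewise linear interpolation of a convex function with mesh h
    errs by at most a constant times h. *)

Lemma eq_measure_rectangles d1 d2 (T1 : measurableType d1)
    (T2 : measurableType d2) (R : realType)
    (m1 m2 : {measure set (T1 * T2) -> \bar R}) :
  (m1 setT < +oo)%E ->
  (forall A B, measurable A -> measurable B -> m1 (A `*` B) = m2 (A `*` B)) ->
  forall X, measurable X -> m1 X = m2 X.
Proof.
move=> m1oo m12.
pose C := [set A `*` B | A in measurable & B in measurable] : set (set (T1 * T2)).
apply: (measure_unique C (fun=> setT)) => //.
- by rewrite measurable_prod_measurableType.
- move=> _ _ [A mA [B mB <-]] [A' mA' [B' mB' <-]]; rewrite -setXI.
  by exists (A `&` A'); [exact: measurableI|exists (B `&` B') => //;
    exact: measurableI].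
- by move=> _; exists setT => //; exists setT => //; rewrite setXTT.
- by apply/seteqP; split => // x _; exists 0%N.
- by move=> _ [A mA [B mB <-]]; exact: m12.
Qed.

Lemma eq_measure_ge_rays (R : realType) (m1 m2 : {measure set R -> \bar R}) :
  (m1 setT < +oo)%E ->
  (forall x, m1 `[x, +oo[%classic = m2 `[x, +oo[%classic) ->
  forall A, measurable A -> m1 A = m2 A.
Proof.
move=> m1oo m12.
apply: (measure_unique (@RGenCInfty.G R) (fun n => `[- (n%:R), +oo[%classic)).
- exact: RGenCInfty.measurableE.
- move=> _ _ [x ->] [y ->]; exists (Num.max x y).
  apply/seteqP; split => z /=; rewrite !in_itv /= !andbT ge_max.
  + by move=> [-> ->].
  + by move/andP.
- by move=> n; eexists.
- apply/seteqP; split => // x _; exists (Num.truncn `|x|).+1 => //=.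
  rewrite in_itv/= andbT lerNl; apply: le_trans (ltW (truncnS_gt _)).
  by rewrite -normrN ler_norm.
- by move=> _ [x ->].
- by move=> k; apply: le_lt_trans m1oo; apply: le_measure; rewrite ?inE.
Qed.

Lemma eq_measure_gt_rays (R : realType) (m1 m2 : {measure set R -> \bar R}) :
  (m1 setT < +oo)%E ->
  (forall x, m1 `]x, +oo[%classic = m2 `]x, +oo[%classic) ->
  forall A, measurable A -> m1 A = m2 A.
Proof.
move=> m1oo m12.
apply: (measure_unique (@RGenOInfty.G R) (fun n => `]- (n%:R), +oo[%classic)).
- exact: RGenOInfty.measurableE.
- move=> _ _ [x ->] [y ->]; exists (Num.max x y).
  apply/seteqP; split => z /=; rewrite !in_itv /= !andbT gt_max.
  + by move=> [-> ->].
  + by move/andP.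
- by move=> n; eexists.
- apply/seteqP; split => // x _; exists (Num.truncn `|x|).+1 => //=.
  rewrite in_itv/= andbT ltrNl; apply: le_lt_trans (truncnS_gt _).
  by rewrite -normrN ler_norm.
- by move=> _ [x ->].
- by move=> k; apply: le_lt_trans m1oo; apply: le_measure; rewrite ?inE.
Qed.

Lemma eq_measure_le_rays (R : realType) (m1 m2 : {measure set R -> \bar R}) :
  (m1 setT < +oo)%E ->
  (forall x, m1 `]-oo, x]%classic = m2 `]-oo, x]%classic) ->
  forall A, measurable A -> m1 A = m2 A.
Proof.
move=> m1oo m12.
(* Passing to complements requires equal total masses; these are recovered as limits along the rays
   []-oo, n]]. *)
have m12T : m1 setT = m2 setT.
  pose E (n : nat) : set R := `]-oo, n%:R]%classic.
  have ET : setT = \bigcup_n E n.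
    apply/seteqP; split => // x _; exists (Num.truncn `|x|).+1 => //=.
    by rewrite /E/= in_itv/=; apply: le_trans (ler_norm _) (ltW (truncnS_gt _)).
  have ndE : nondecreasing_seq E.
    move=> i j ij; apply/subsetPset => x; rewrite /E/= !in_itv/= => /le_trans;
      apply.
    by rewrite ler_nat.
  have mE n : measurable (E n) by exact: measurable_itv.
  have cE (m : {measure set R -> \bar R}) : m (E n) @[n --> \oo] --> m setT.
    by rewrite ET; apply: nondecreasing_cvg_mu => //; exact: bigcupT_measurable.
  have m12E : (fun n => m1 (E n)) = (fun n => m2 (E n)) by apply/funext => n;
    exact: m12.
  have := cE m1; rewrite m12E => c; exact: cvg_unique c (cE m2).
apply: eq_measure_gt_rays => // x.
have mE (m : {measure set R -> \bar R}) : (m setT < +oo)%E ->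
    m `]x, +oo[%classic = (m setT - m `]-oo, x]%classic)%E.
  by move=> moo; rewrite -setCitvl -setTD measureD// setTI.
by rewrite !mE -?m12T// m12.
Qed.

Section semidirect_product.
Context d1 d2 (T1 : measurableType d1) (T2 : measurableType d2) (R : realType).
Variables (m : {measure set T1 -> \bar R}) (K : R.-pker T1 ~> T2).

(** The joint law of a pair whose first component has law [m] and whose second component has
    conditional law [K]. *)
Definition semidirect (A : set (T1 * T2)) : \bar R :=
  (\int[m]_x K x (xsection A x))%E.

Lemma measurable_kernel_xsection (A : set (T1 * T2)) : measurable A ->
  measurable_fun setT (fun x => K x (xsection A x)).
Proof.
by move=> mA; apply: measurable_fun_xsection_finite_kernel; rewrite inE.
Qed.

Let semidirect0 : semidirect set0 = 0%E.
Proof. by apply: integral0_eq => x _; rewrite xsection0 measure0. Qed.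

Let semidirect_ge0 A : (0 <= semidirect A)%E.
Proof. exact: integral_ge0. Qed.

Let semidirect_sigma_additive : semi_sigma_additive semidirect.
Proof.
move=> F mF tF mUF.
have -> : semidirect (\bigcup_n F n) = (\sum_(n <oo) semidirect (F n))%E.
  rewrite /semidirect -integral_nneseries//; last first.
    by move=> n; exact: measurable_kernel_xsection.
  apply: eq_integral => x _; apply/esym/cvg_lim => //=; rewrite xsection_bigcup.
  apply: (measure_sigma_additive _ (trivIset_xsection tF)) => n.
  exact: measurable_xsection.
exact: is_cvg_ereal_nneg_natsum.
Qed.

HB.instance Definition _ := isMeasure.Build _ _ R semidirect
  semidirect0 semidirect_ge0 semidirect_sigma_additive.

End semidirect_product.

(** Both sides are finite measures in [A]: the joint law and the semidirect product of the law of
    [X] with [K]. The definition of a regular conditional distribution makes them agree on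
    rectangles. *)
Lemma regular_cond_distributionE d (T : measurableType d)
    d1 (T1 : measurableType d1) d2 (T2 : measurableType d2) (R : realType)
    (P : probability T R) (Y : {RV P >-> T2}) (X : {RV P >-> T1})
    (K : R.-pker T1 ~> T2) : regular_cond_distribution P Y X K ->
  forall A, measurable A ->
  P [set w | A (X w, Y w)] = (\int[P]_w K (X w) (xsection A (X w)))%E.
Proof.
move=> PK A mA.
have mXY : measurable_fun setT (fun w => (X w, Y w)) by exact: measurable_fun_pair.
transitivity (pushforward P (fun w => (X w, Y w)) A) => //.
rewrite (eq_measure_rectangles (m2 := semidirect (distribution P X) K))//.
- rewrite /= /semidirect ge0_integral_distribution//.
  exact: measurable_kernel_xsection.
- by rewrite /= /pushforward preimage_setT probability_setT ltry.
- move=> B C mB mC.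
  rewrite /= /semidirect ge0_integral_distribution//; last first.
    by apply: measurable_kernel_xsection; exact: measurableX.
  transitivity (P (X @^-1` B `&` Y @^-1` C)) => //.
  rewrite PK// integral_mkcond; apply: eq_integral => w _ /=.
  rewrite patchE; case: ifPn => XB.
    by rewrite in_xsectionX// inE; move: XB; rewrite inE.
  by rewrite notin_xsectionX ?measure0// notin_setE; move: XB; rewrite notin_setE.
Qed.

(** * Quantiles and left limits of distribution functions *)

Lemma cdf_itv01 (R : realType) (G : R -> R) y : is_cdf G -> 0 <= G y <= 1.
Proof.
case=> Gnd _ G0 G1; apply/andP; split; rewrite leNgt; apply/negP => Gy.
- have [x /andP[Gyx xy]] : exists x, (G y < G x) && (x <= y).
    apply: (@filter_ex _ (-oo)%R); near=> x; apply/andP; split; near: x.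
      exact: (cvgr_gt _ G0).
    by apply: nbhs_ninfty_le; exact: num_real.
  by have := lt_le_trans Gyx (Gnd _ _ xy); rewrite ltxx.
- have [x /andP[Gyx xy]] : exists x, (G x < G y) && (y <= x).
    apply: (@filter_ex _ (+oo)%R); near=> x; apply/andP; split; near: x.
      exact: (cvgr_lt _ G1).
    by apply: nbhs_pinfty_ge; exact: num_real.
  by have := lt_le_trans Gyx (Gnd _ _ xy); rewrite ltxx.
Unshelve. all: by end_near. Qed.

(** Right-continuity makes the infimum attained. This Galois connection is the only access to
    quantiles used below. *)
Lemma quantile_le (R : realType) (G : R -> R) v y :
  is_cdf G -> 0 < v < 1 -> (quantile G v <= y) = (v <= G y).
Proof.
case=> Gnd Grc G0 G1 v01; rewrite /quantile v01; move/andP: v01 => [v0 v1].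
have [l Gl] : exists l, G l < v.
  by apply: (@filter_ex _ (-oo)%R); exact: (cvgr_lt _ G0).
have [u Gu] : exists u, v < G u.
  by apply: (@filter_ex _ (+oo)%R); exact: (cvgr_gt _ G1).
have lbA : lbound [set x | v <= G x] l.
  move=> x /= vGx; rewrite leNgt; apply/negP => xl.
  by have := lt_le_trans Gl (le_trans vGx (Gnd _ _ (ltW xl))); rewrite ltxx.
have infA : has_inf [set x | v <= G x].
  by split; [exists u; exact: ltW|exists l].
apply/idP/idP => [qy|vGy]; last by apply: ge_inf => //; exists l.
apply: le_trans (Gnd _ _ qy).
apply: (cvgr_to_ge (Grc _)); near=> x.
have [z /= vGz zx] : exists2 z, v <= G z & z < x.
  by apply: inf_lt; [exact: infA.1|near: x; exact: nbhs_right_gt].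
exact: le_trans vGz (Gnd _ _ (ltW zx)).
Unshelve. all: by end_near. Qed.

(** For nondecreasing [G] this is G(q-). As a supremum, it turns a strict lower bound into the
    existence of a point left of [q], with no filter involved. *)
Definition left_limit (R : realType) (G : R -> R) (q : R) : R :=
  sup [set G y | y in [set y | y < q]].

Section left_limit_cdf.
Context (R : realType) (G : R -> R) (G_cdf : is_cdf G).

Lemma has_sup_left_limit q : has_sup [set G y | y in [set y | y < q]].
Proof.
split; first by exists (G (q - 1)), (q - 1) => //=; rewrite ltrBlDr ltrDl.
by exists 1 => _ [y _ <-]; case/andP: (cdf_itv01 y G_cdf).
Qed.

Lemma left_limit_ge y q : y < q -> G y <= left_limit G q.
Proof.
by move=> yq; apply: sup_upper_bound; [exact: has_sup_left_limit|exists y].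
Qed.

Lemma left_limit_gt w q : w < left_limit G q -> exists2 y, y < q & w < G y.
Proof.
move=> /(sup_gt (has_sup_left_limit q).1)[_ [y yq <-] wy].
by exists y.
Qed.

Lemma left_limit_itv01 q : 0 <= left_limit G q <= 1.
Proof.
apply/andP; split.
  apply: le_trans (@left_limit_ge (q - 1) _ _); last by rewrite ltrBlDr ltrDl.
  by case/andP: (cdf_itv01 (q - 1) G_cdf).
apply: ge_sup; first exact: (has_sup_left_limit q).1.
by move=> _ [y _ <-]; case/andP: (cdf_itv01 y G_cdf).
Qed.

(** With the next lemma, [quantile G v < q] is decided by comparing [v] with G(q-), except at the
    single level v = G(q-), which is null for a uniform [v]. *)
Lemma quantile_lt_left_limit v q :
  0 < v < 1 -> quantile G v < q -> v <= left_limit G q.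
Proof.
move=> v01 vq; apply: le_trans (left_limit_ge vq).
by rewrite -quantile_le.
Qed.

Lemma lt_left_limit_quantile v q :
  0 < v < 1 -> v < left_limit G q -> quantile G v < q.
Proof.
move=> v01 /left_limit_gt[y yq vy]; apply: le_lt_trans yq.
by rewrite quantile_le// ltW.
Qed.

(** Countable form of the supremum, from which follow the measurability of left limits in a
    parameter and the passage of laws to left limits. *)
Lemma left_limit_gt_bigcup w q :
  w < left_limit G q <-> exists n, w < G (q - n.+1%:R^-1).
Proof.
split=> [/left_limit_gt[y yq wy]|[n wn]].
  have [n yn] := ltr_add_invr yq; exists n.
  apply: lt_le_trans wy _; case: G_cdf => Gnd _ _ _; apply: Gnd.
  by rewrite lerBrDr ltW.
by apply: lt_le_trans wn _; apply: left_limit_ge; rewrite ltrBlDr ltrDl invr_gt0.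
Qed.

End left_limit_cdf.

Lemma is_cdf_distribution d (T : measurableType d) (R : realType)
  (P : probability T R) (Y : {RV P >-> R}) : is_cdf (df Y).
Proof.
have fin y : cdf Y y \is a fin_num by rewrite fin_num_measure.
split.
- by move=> x y xy; rewrite fine_le// cdf_nondecreasing.
- by move=> x; apply: fine_cvg; rewrite fineK//; exact: cdf_right_continuous.
- exact/fine_cvg/cvg_cdfNy0.
- exact/fine_cvg/cvg_cdfy1.
Qed.

Section probability_of_measure.
Context d (T : measurableType d) (R : realType).
Variables (m : {measure set T -> \bar R}) (m1 : m setT = 1%E).

(** The discarded [let] keeps the proof [m1] inside the term, so that the probability structure can
    be attached to it. *)
Definition probability_of_measure : set T -> \bar R := let _ := m1 in m.

HB.instance Definition _ := Measure.on probability_of_measure.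
HB.instance Definition _ :=
  Measure_isProbability.Build _ _ _ probability_of_measure m1.

End probability_of_measure.

Lemma is_cdf_measure (R : realType) (m : {measure set R -> \bar R}) :
  m setT = 1%E -> is_cdf (fun y => fine (m `]-oo, y]%classic)).
Proof.
move=> m1; pose P : probability R R := probability_of_measure m1.
have id_meas : measurable_fun setT (@idfun R) by exact: measurable_id.
pose I : {mfun R >-> R} := HB.pack (@idfun R) (isMeasurableFun.Build _ _ _ _ _
  id_meas).
exact: (is_cdf_distribution (I : {RV P >-> R})).
Qed.

Lemma left_limit_measure (R : realType) (m : {measure set R -> \bar R}) q :
  m setT = 1%E ->
  left_limit (fun y => fine (m `]-oo, y]%classic)) q = fine (m `]-oo, q[%classic).
Proof.
move=> m1; have G_cdf := is_cdf_measure m1.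
have fin A : measurable A -> m A \is a fin_num.
  by move=> mA; apply: lty_fin_num_fun; rewrite ?m1 ?ltry.
apply/eqP; rewrite eq_le; apply/andP; split.
  apply: ge_sup; first exact: (has_sup_left_limit G_cdf q).1.
  move=> _ [y yq <-]; apply: fine_le; [exact: fin|exact: fin|].
  apply: le_measure; rewrite ?inE//= => x /=; rewrite !in_itv/= => xy.
  exact: le_lt_trans xy yq.
have -> : `]-oo, q[%classic = \bigcup_n `]-oo, q - n.+1%:R^-1]%classic.
  apply/seteqP; split => x /=; rewrite in_itv/=.
    move=> xq; have [n xn] := ltr_add_invr xq; exists n => //=.
    by rewrite in_itv/= lerBrDr ltW.
  move=> [n _]; rewrite /= in_itv/= => /le_lt_trans; apply.
  by rewrite ltrBlDr ltrDl invr_gt0.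
have mF n : measurable `]-oo, q - n.+1%:R^-1]%classic by [].
rewrite -lee_fin fineK; last by apply: fin; exact: bigcup_measurable.
have ndF : nondecreasing_seq (fun n => `]-oo, q - n.+1%:R^-1]%classic).
  move=> i j ij; apply/subsetPset => x /=; rewrite !in_itv/= => /le_trans; apply.
  by rewrite lerB// lef_pV2 ?posrE// ler_nat.
have mUF : measurable (\bigcup_n `]-oo, q - n.+1%:R^-1]%classic).
  exact: bigcup_measurable.
apply: (cvge_to_le (nondecreasing_cvg_mu mF mUF ndF)).
near=> n; rewrite /= -(fineK (fin _ (mF n))) lee_fin.
by apply: (left_limit_ge G_cdf); rewrite ltrBlDr ltrDl invr_gt0.
Unshelve. all: by end_near. Qed.

Section measurable_quantile.
Context d (T : measurableType d) (R : realType) (G : T -> R -> R).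
Hypotheses (G_cdf : forall x, is_cdf (G x))
  (mG : forall y, measurable_fun setT (G ^~ y)).

(** The Galois connection turns the level set y < G_x^{-1}(v) into G_x(y) < v, so measurability in x
    at each fixed y yields joint measurability in (x, v). *)
Lemma measurable_quantile :
  measurable_fun setT (fun z : T * R => quantile (G z.1) z.2).
Proof.
apply: (measurability (@RGenOInfty.G R)); first exact: RGenOInfty.measurableE.
move=> _ [_ [y ->] <-]; rewrite setTI.
(* The second branch reflects the default value 0 of [quantile] outside (0,1). *)
pose b (z : T * R) := if (0 < z.2) && (z.2 < 1) then G z.1 y < z.2 else y < 0.
have -> : (fun z : T * R => quantile (G z.1) z.2) @^-1` `]y, +oo[ = b @^-1`
  [set true].
  have qE z : (y < quantile (G z.1) z.2) = b z.
    rewrite /b; case: ifPn => z01; first by rewrite !ltNge quantile_le.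
    by rewrite /quantile (negbTE z01).
  by apply/seteqP; split => z /=; rewrite in_itv/= andbT qE.
have mb : measurable_fun setT b.
  apply: measurable_fun_ifT => //.
    apply: measurable_and; apply: measurable_fun_ltr => //.
  by apply: measurable_fun_ltr => //; exact: (measurableT_comp (mG y)).
by rewrite -[_ @^-1` _]setTI; exact: mb.
Qed.

Lemma measurable_left_limit q : measurable_fun setT (fun x => left_limit (G x) q).
Proof.
apply: (measurability (@RGenOInfty.G R)); first exact: RGenOInfty.measurableE.
move=> _ [_ [y ->] <-]; rewrite setTI.
have -> : (fun x => left_limit (G x) q) @^-1` `]y, +oo[ =
    \bigcup_n (G ^~ (q - n.+1%:R^-1)) @^-1` `]y, +oo[.
  apply/seteqP; split => x /=; rewrite in_itv/= andbT.
    by move/(left_limit_gt_bigcup (G_cdf x)) => [n yn]; exists n => //=;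
      rewrite in_itv/= andbT.
  move=> [n _] /=; rewrite in_itv/= andbT => yn.
  by apply/(left_limit_gt_bigcup (G_cdf x)); exists n.
apply: bigcup_measurable => n _; rewrite -[_ @^-1` _]setTI; exact: mG.
Qed.

End measurable_quantile.

(** * Uniform random variables *)

(** The uniform density is supported on the closed interval, whereas quantiles and [F] are
    meaningful on the open one; the two endpoints are null. *)
Lemma uniform01_probE (R : realType) (A : set R) : measurable A ->
  uniform_prob (@ltr01 R) A = lebesgue_measure (`]0, 1[%classic `&` A).
Proof.
move=> mA.
have mAI : measurable (A `&` `[0%R, 1%R]) by exact: measurableI.
rewrite /uniform_prob integral_uniform_pdf.
transitivity (\int[lebesgue_measure]_(x in A `&` `[0%R, 1%R]) (1 : R)%:E)%E.
  apply: eq_integral => x; rewrite inE/= in_itv/= => -[_ x01].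
  by rewrite /uniform_pdf x01 subr0 invr1.
rewrite integral_cst// mul1e; apply/eqP; rewrite eq_le; apply/andP; split.
  have -> : A `&` `[0%R, 1%R] = (A `&` `]0, 1[) `|` (A `&` [set 0%R; 1%R]).
    rewrite -setIUr; congr (_ `&` _); apply/seteqP; split => x /=;
      rewrite !in_itv/=.
      move=> /andP[]; rewrite !le_eqVlt => /predU1P[->|->] /predU1P[->|->] /=; auto.
    by move=> [/andP[/ltW -> /ltW ->]//|[->|->]]; rewrite lexx ler01.
  apply: (le_trans (measureU2 _ _ _)).
  - exact: measurableI.
  - by apply: measurableI => //; apply: measurableU.
  rewrite setIC -[leRHS]adde0 leeD2l//.
  apply: (@le_trans _ _ (lebesgue_measure ([set 0%R; 1%R] : set R))).
    by apply: le_measure; rewrite ?inE//; [apply: measurableI => //|];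
      apply: measurableU.
  rewrite countable_lebesgue_measure0//; apply: finite_set_countable.
  by rewrite finite_setU; split; exact: finite_set1.
apply: le_measure; rewrite ?inE//; first exact: measurableI.
by rewrite setIC; apply: setIS; apply: subset_itv_oo_cc.
Qed.

(** Within (0,1), [A] is squeezed between []a, 1[] and [[a, 1[], which have the same length. This is
    exactly the information that the left-limit lemmas give about quantile events. *)
Lemma uniform01_upper (R : realType) (A : set R) a :
  measurable A -> 0 <= a <= 1 ->
  (forall x, 0 < x < 1 -> a < x -> A x) ->
  (forall x, 0 < x < 1 -> A x -> a <= x) ->
  uniform_prob (@ltr01 R) A = (1 - a)%:E.
Proof.
move=> mA /andP[a0 a1] aA Aa; rewrite uniform01_probE//.
have mA' : measurable (`]0%R, 1%R[%classic `&` A) by exact: measurableI.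
apply/eqP; rewrite eq_le; apply/andP; split.
  rewrite (_ : (1 - a)%:E = lebesgue_measure `[a, 1%R[%classic); last first.
    rewrite lebesgue_measure_itv/= lte_fin; case: ltP => a1'; rewrite ?EFinB//.
    by rewrite -EFinB (@le_anti _ _ a 1) ?a1// subrr.
  apply: le_measure; rewrite ?inE// => x /= [+ Ax]; rewrite !in_itv/= => x01.
  by rewrite Aa//; case/andP: x01.
rewrite (_ : (1 - a)%:E = lebesgue_measure `]a, 1%R[%classic); last first.
  rewrite lebesgue_measure_itv/= lte_fin; case: ltP => a1'; rewrite ?EFinB//.
  by rewrite -EFinB (@le_anti _ _ a 1) ?a1// subrr.
apply: le_measure; rewrite ?inE// => x /=; rewrite !in_itv/= => /andP[ax x1].
have x01 : 0 < x < 1 by rewrite (le_lt_trans a0 ax).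
by split => //; exact: aA.
Qed.

Lemma uniform01_lower (R : realType) (A : set R) a :
  measurable A -> 0 <= a <= 1 ->
  (forall x, 0 < x < 1 -> x < a -> A x) ->
  (forall x, 0 < x < 1 -> A x -> x <= a) ->
  uniform_prob (@ltr01 R) A = a%:E.
Proof.
move=> mA a01 aA Aa.
rewrite -[A]setCK probability_setC; last exact: measurableC.
rewrite [X in (_ - X)%E](_ : _ = (1 - a)%:E).
  by rewrite -EFinB opprB addrCA subrr addr0.
apply: uniform01_upper => //.
- exact: measurableC.
- by move=> x x01 ax /(Aa _ x01); rewrite leNgt ax.
- by move=> x x01 nAx; rewrite leNgt; apply/negP => /(aA _ x01).
Qed.

Section independence.
Context d (T : measurableType d) (R : realType) (P : probability T R).
Context d1 (T1 : measurableType d1) (V : {RV P >-> R}) (X : {RV P >-> T1}).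
Hypotheses (V_unif : uniform01 V) (VX : independent_rv P V X).

(** Independence says that the constant kernel equal to the law of [V] is a regular conditional
    distribution of [V] given [X]. *)
Lemma independent_rvE (A : set (T1 * R)) : measurable A ->
  P [set w | A (X w, V w)] =
  (\int[P]_w distribution P V (xsection A (X w)))%E.
Proof.
move=> mA.
pose K : R.-pker T1 ~> R := kprobability
  (@measurable_cst _ _ T1 (pprobability R R) setT (distribution P V)).
have PK : regular_cond_distribution P V X K.
  by move=> B C mB mC; rewrite setIC VX// integral_cst//; exact: measurable_funPTI.
by rewrite (regular_cond_distributionE PK).
Qed.

Variable G : T1 -> R -> R.
Hypotheses (G_cdf : forall x, is_cdf (G x))
  (mG : forall y, measurable_fun setT (G ^~ y)).

(** Given X = x, the event is V > max(G_x(q-), t) up to a null set. Both transforms use this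
    formula: the conditional one with [B] the whole space, the rearranged one with U as conditioning
    variable, [B] a ray and t = 0. *)
Lemma prob_quantile_ge q (B : set T1) t : measurable B -> 0 <= t <= 1 ->
  P [set w | [/\ q <= quantile (G (X w)) (V w), B (X w) & t < V w]] =
  (\int[P]_w (\1_B (X w) * (1 - Num.max (left_limit (G (X w)) q) t))%:E)%E.
Proof.
move=> mB /andP[t0 t1].
pose A := [set z : T1 * R | [/\ q <= quantile (G z.1) z.2, B z.1 & t < z.2]].
have mA : measurable A.
  rewrite (_ : A = ((fun z : T1 * R => quantile (G z.1) z.2) @^-1` `[q, +oo[ `&`
      (fst @^-1` B)) `&` (snd @^-1` `]t, +oo[)); last first.
    apply/seteqP; split => z /=; rewrite !in_itv/= !andbT.
      by case.
    by move=> [[]].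
  apply: measurableI; first apply: measurableI.
  - rewrite -[_ @^-1` _]setTI; exact: measurable_quantile.
  - rewrite -[_ @^-1` _]setTI; exact: measurable_fst.
  - rewrite -[_ @^-1` _]setTI; exact: measurable_snd.
transitivity (P [set w | A (X w, V w)]) => //.
rewrite independent_rvE//; apply: eq_integral => w _.
rewrite V_unif; last exact: measurable_xsection.
have [XB|XB] := pselect (B (X w)); last first.
  rewrite indicE memNset// mul0r (_ : xsection A (X w) = set0) ?measure0//.
  by rewrite -subset0 => r; rewrite xsectionE/= /A/= => -[].
rewrite indicE mem_set// mul1r.
have /andP[L0 L1] := left_limit_itv01 (G_cdf (X w)) q.
rewrite (@uniform01_upper _ _ (Num.max (left_limit (G (X w)) q) t))//.
- exact: measurable_xsection.
- by rewrite le_max L0 ge_max L1 t1.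
- move=> x x01; rewrite gt_max => /andP[Lx tx]; rewrite xsectionE/=; split => //=.
  rewrite leNgt; apply/negP => /(quantile_lt_left_limit (G_cdf (X w)) x01).
  by rewrite leNgt Lx.
- move=> x x01; rewrite xsectionE/= => -[/= qx _ tx]; rewrite ge_max (ltW tx) andbT.
  rewrite leNgt; apply/negP => /(lt_left_limit_quantile (G_cdf (X w)) x01).
  by rewrite ltNge qx.
Qed.
End independence.
Definition mfun_of d d' (T : measurableType d) (T' : measurableType d')
    (f : T -> T') (mf : measurable_fun setT f) : {mfun T >-> T'} :=
  HB.pack f (isMeasurableFun.Build _ _ _ _ f mf).

(* [uniform_prob] is a measure for the measurable structure [measurableTypeR R],
   which has the same measurable sets as that of [R] but another display. *)
Definition unif01 (R : realType) : set R -> \bar R := uniform_prob (@ltr01 R).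

HB.instance Definition _ (R : realType) := isMeasure.Build _ R R (@unif01 R)
  (measure0 (uniform_prob (@ltr01 R))) (measure_ge0 (uniform_prob (@ltr01 R)))
  (@measure_semi_sigma_additive _ _ _ (uniform_prob (@ltr01 R))).

HB.instance Definition _ (R : realType) := Measure_isProbability.Build _ R R
  (@unif01 R) (probability_setT (uniform_prob (@ltr01 R))).

(** Inverse transform sampling: by the Galois connection the quantile falls in []-oo, y]] exactly
    when the uniform level is at most G(y), and such rays determine a measure. *)
Lemma unif01_quantile (R : realType) (m : {measure set R -> \bar R}) C :
  m setT = 1%E -> measurable C ->
  unif01 [set b | C (quantile (fun y => fine (m `]-oo, y]%classic)) b)] = m C.
Proof.
move=> m1 mC; have G_cdf := is_cdf_measure m1.
set G := fun y => _ in G_cdf *.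
have mq : measurable_fun setT (quantile G).
  have mq := @measurable_quantile _ _ R (fun=> G) (fun x : R => G_cdf)
     (fun y => @measurable_cst _ _ R R setT (G y)).
  by have := measurableT_comp mq (measurable_fun_pair (@measurable_id _ R setT)
    (@measurable_id _ R setT)).
transitivity (pushforward (@unif01 R) (mfun_of mq) C) => //.
apply: eq_measure_le_rays => //.
- by rewrite /= /pushforward preimage_setT probability_setT ltry.
- move=> y; rewrite /= /pushforward.
  have mA : measurable (quantile G @^-1` `]-oo, y]) by rewrite -[_ @^-1`
    _]setTI; exact: mq.
  rewrite -[RHS]fineK; last by apply: lty_fin_num_fun; rewrite ?m1 ?ltry.
  apply: uniform01_lower => //; first exact: cdf_itv01 G_cdf.
  + by move=> x x01 xG; rewrite /= in_itv/= (quantile_le _ G_cdf)// ltW.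
  + by move=> x x01; rewrite /= in_itv/= (quantile_le _ G_cdf).
Qed.

(** * The quantile transform of a uniform vector *)

Lemma measurable_preimage d1 d2 (T1 : measurableType d1) (T2 : measurableType d2)
    (f : T1 -> T2) (A : set T2) :
  measurable_fun setT f -> measurable A -> measurable [set x | A (f x)].
Proof. by move=> mf mA; have := mf measurableT _ mA; rewrite setTI. Qed.

Section uniform_cube.
Variable R : realType.

Definition rcons_pair k (z : k.-tuple R * R) : k.+1.-tuple R :=
  [tuple of rcons z.1 z.2].

Lemma tnth_rcons_pair k (z : k.-tuple R * R) (i : 'I_k.+1) :
  tnth (rcons_pair z) i = if (i < k)%N then (z.1)`_i else z.2.
Proof.
rewrite (tnth_nth 0)/= nth_rcons size_tuple; case: ltnP => // ki.
by rewrite (_ : _ == _)// eqn_leq ki -ltnS ltn_ord.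
Qed.

Lemma measurable_tuple_nth k (j : nat) :
  measurable_fun setT (fun u : k.-tuple R => u`_j).
Proof.
have [jk|kj] := ltnP j k.
  rewrite (_ : (fun u : k.-tuple R => u`_j) = fun u => tnth u (Ordinal jk)).
    exact: measurable_tnth.
  by apply/funext => u; rewrite (tnth_nth 0).
rewrite (_ : (fun u : k.-tuple R => u`_j) = cst 0)//.
by apply/funext => u; rewrite nth_default// size_tuple.
Qed.

Lemma measurable_rcons_pair k : measurable_fun setT (@rcons_pair k).
Proof.
apply/measurable_fun_tnthP => i; rewrite /comp.
under eq_fun do rewrite tnth_rcons_pair.
case: (i < k)%N; last exact: measurable_snd.
have := measurableT_comp (@measurable_tuple_nth k i) (@measurable_fst _ _
  (k.-tuple R) R).
exact.
Qed.

Fixpoint uniform_cube k : probability (k.-tuple R) R :=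
  match k with
  | 0%N => \d_[tuple]
  | k'.+1 => distribution (uniform_cube k' \x @unif01 R)%E
               (mfun_of (@measurable_rcons_pair k'))
  end.

Definition cons_pair k (z : R * k.-tuple R) : k.+1.-tuple R :=
  [tuple of z.1 :: z.2].

Lemma measurable_cons_pair k : measurable_fun setT (@cons_pair k).
Proof. exact: measurable_cons. Qed.

Lemma uniform_cube_rcons k A : measurable A ->
  uniform_cube k.+1 A =
  (\int[uniform_cube k]_u (@unif01 R [set b | A (rcons_pair (u, b))]))%E.
Proof.
move=> mA; apply: eq_integral => u _ /=.
by rewrite xsectionE.
Qed.

Lemma measurable_section2 d1 d2 (T1 : measurableType d1) (T2 : measurableType d2)
  d3 (T3 : measurableType d3) (f : T1 * T2 -> T3) (A : set T3) x :
  measurable_fun setT f -> measurable A -> measurable [set y | A (f (x, y))].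
Proof.
move=> mf mA; apply: measurable_preimage mA.
exact: (measurableT_comp mf (measurable_fun_pair (@measurable_cst _ _ T2 T1
  setT x) (@measurable_id _ T2 setT))).
Qed.

Lemma measurable_fun_section2 d1 d2 (T1 : measurableType d1) (T2 :
  measurableType d2)
  d3 (T3 : measurableType d3) (m : {sigma_finite_measure set T2 -> \bar R})
  (f : T1 * T2 -> T3) (A : set T3) :
  measurable_fun setT f -> measurable A ->
  measurable_fun setT (fun x => m [set y | A (f (x, y))]).
Proof.
move=> mf mA.
have mfA : measurable (f @^-1` A) by rewrite -[_ @^-1` _]setTI; exact: mf.
have := measurable_fun_xsection m mfA.
apply: eq_measurable_fun => x _ /=.
by rewrite xsectionE.
Qed.

(* [uniform_cube] is built by appending coordinates, as in [quantile_transform],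
   whereas [lebesgue_tuple] prepends them. *)
Lemma uniform_cube_cons k A : measurable A ->
  uniform_cube k.+1 A =
  (\int[@unif01 R]_a (uniform_cube k [set u | A (cons_pair (a, u))]))%E.
Proof.
elim: k A => [|k IH] A mA.
  rewrite uniform_cube_rcons// integral_dirac//=; last first.
    by apply: measurable_fun_section2 => //; exact: measurable_rcons_pair.
  rewrite diracT mul1e.
  have mB : measurable [set a | A (cons_pair (a, [tuple]))].
    apply: measurable_preimage mA.
    exact: (measurableT_comp (@measurable_cons_pair 0) (measurable_fun_pair
      (@measurable_id _ R setT) (@measurable_cst _ _ R (0.-tuple R) setT [tuple]))).
  rewrite (_ : [set b | _] = [set a | A (cons_pair (a, [tuple]))]); last first.
    apply/seteqP; split => b /=; by rewrite (_ : rcons_pair _ = cons_pair (b,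
      [tuple]))//; apply: val_inj.
  transitivity (\int[@unif01 R]_(a in setT) (\1_[set a | A (cons_pair (a,
    [tuple]))] a)%:E)%E.
    by rewrite integral_indic// setIT.
  by apply: eq_integral => a _; rewrite /= diracE indicE;
    congr ((_ : bool)%:R%:E); apply/idP/idP; rewrite !inE.
rewrite uniform_cube_rcons//.
set g := (fun u => _).
have mg : measurable_fun setT g.
  by apply: measurable_fun_section2 => //; exact: measurable_rcons_pair.
(* The last coordinate has already been removed; the induction hypothesis now splits off the first
   one. Tonelli puts the first coordinate outside, and the last one is then appended again. *)
rewrite (eq_measure_integral (pushforward (@unif01 R \x uniform_cube k)%E
  (mfun_of (@measurable_cons_pair k)))); last first.
  move=> B mB _; apply: (etrans (IH B mB)); apply: eq_integral => a _ /=.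
  by rewrite xsectionE.
rewrite (ge0_integral_pushforward (@measurable_cons_pair k) _ measurableT mg)//.
have mgc : measurable_fun setT (g \o @cons_pair k).
  exact: (measurableT_comp mg (@measurable_cons_pair k)).
rewrite preimage_setT.
have := @fubini_tonelli1 _ _ R _ _ (@unif01 R) (uniform_cube k) (g \o
  @cons_pair k) mgc (fun z => measure_ge0 _ _).
move=> ->.
rewrite /fubini_F.
apply: eq_integral => a _; rewrite [RHS]uniform_cube_rcons; last first.
  by apply: measurable_section2 => //; exact: measurable_cons_pair.
apply: eq_integral => u _; rewrite /g /=; congr (unif01 _).
by apply/seteqP; split => b /=; rewrite (_ : rcons_pair _ = cons_pair (a,
  rcons_pair (u, b)))//; apply: val_inj.
Qed.
End uniform_cube.
Lemma integral_unif01 (R : realType) (f : R -> \bar R) :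
  measurable_fun setT f -> (forall x, 0 <= f x)%E ->
  (\int[@unif01 R]_x f x = \int[lebesgue_measure]_(x in `]0%R, 1%R[) f x)%E.
Proof.
move=> mf f0.
(* Pushing forward along this identity carries the integral from one measurable structure on [R] to
   the other. *)
have mid : measurable_fun setT (idfun : measurableTypeR R -> R).
  by move=> _ A mA; rewrite setTI.
transitivity (\int[uniform_prob (@ltr01 R)]_x f x)%E.
  have := ge0_integral_pushforward mid (uniform_prob (@ltr01 R)) measurableT mf
    (fun y _ => f0 y).
  by move=> <-; exact: eq_measure_integral.
rewrite integral_uniform// subr0 invr1 mul1e integral_itv_bndoo//.
exact: measurable_funTS.
Qed.

(** Restriction to the open cube turns each Lebesgue factor into a uniform law. Since
    [lebesgue_tuple] is a bare set function, this identity is what brings the rearrangement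
    condition into the setting of probability measures. *)
Lemma lebesgue_tuple_cube (R : realType) k (A : set (k.-tuple R)) :
  measurable A ->
  lebesgue_tuple (@open_cube R k `&` A) = uniform_cube R k A.
Proof.
elim: k A => [|k IH] A mA.
  rewrite /= (_ : @open_cube R 0 `&` A = A)//.
  by apply/seteqP; split => [u []//|u Au]; split => // -[].
rewrite uniform_cube_cons//.
set h := fun a => uniform_cube R k [set u | A (cons_pair (a, u))].
have mh : measurable_fun setT h.
  by apply: measurable_fun_section2 => //; exact: (@measurable_cons_pair R k).
rewrite (integral_unif01 mh)// integral_mkcond /= /pushforward.
apply: eq_integral => a _ /=; rewrite xsectionE patchE.
have [a01|a01] := boolP (0 < a < 1).
  rewrite mem_set/=; last by rewrite in_itv.
  rewrite /h; apply: (etrans _ (IH _ _)); last first.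
    by apply: measurable_section2 => //; exact: (@measurable_cons_pair R k).
  congr lebesgue_tuple; apply/seteqP; split => u /= [uc uA]; split => //.
    by move=> i; have := uc (lift ord0 i); rewrite tnthS.
  move=> i; have [->|i0] := eqVneq i ord0; first by rewrite tnth0.
  by rewrite eq_sym in i0; have [j -> _] := unlift_some i0; rewrite tnthS.
rewrite memNset/=; last by rewrite in_itv/=; exact/negP.
(* Written as an intersection with the cube, the empty set gets mass zero from the induction
   hypothesis. *)
rewrite [X in lebesgue_tuple X](_ : _ = @open_cube R k `&` set0).
  by rewrite IH// measure0.
rewrite setI0 -subset0 => u /= [/(_ ord0)]; rewrite tnth0 => a01'.
by rewrite a01' in a01.
Qed.
Lemma measurable_cond_df d1 (T1 : measurableType d1) (R : realType)
    (K : R.-pker T1 ~> R) y : measurable_fun setT (fun x => cond_df K x y).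
Proof.
have := measurableT_comp (@fine_measurable R setT measurableT)
  (measurable_kernel K _ (measurable_itv `]-oo, y])).
exact.
Qed.

Lemma is_cdf_cond_df d1 (T1 : measurableType d1) (R : realType)
    (K : R.-pker T1 ~> R) x : is_cdf (cond_df K x).
Proof. by apply: is_cdf_measure; exact: prob_kernel. Qed.

Section quantile_transform.
Context (R : realType) (Q : forall i : nat, R.-pker (i.-tuple R) ~> R).

Lemma quantile_transformS u k : quantile_transform Q u k.+1 =
  rcons_pair (quantile_transform Q u k,
    quantile (cond_df (Q k) (quantile_transform Q u k)) u`_k).
Proof. by []. Qed.

Lemma eq_quantile_transform u v k :
  (forall i, (i < k)%N -> u`_i = v`_i) ->
  quantile_transform Q u k = quantile_transform Q v k.
Proof.
elim: k => // k IH uv; rewrite !quantile_transformS uv// IH// => i ik.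
by apply: uv; exact: ltnW.
Qed.

Lemma measurable_quantile_transform n k :
  measurable_fun setT (fun u : n.-tuple R => quantile_transform Q u k).
Proof.
elim: k => [|k IH]; first exact: measurable_cst.
have mq := measurable_quantile (is_cdf_cond_df (Q k)) (measurable_cond_df (Q k)).
have := measurableT_comp mq (measurable_fun_pair IH (@measurable_tuple_nth R n k)).
move=> /(measurable_fun_pair IH)/(measurableT_comp (@measurable_rcons_pair R k)).
exact.
Qed.

Lemma first_coordsS p k (x : p.-tuple R) :
  first_coords k.+1 x = rcons_pair (first_coords k x, x`_k).
Proof.
apply: eq_from_tnth => i; rewrite tnth_mktuple tnth_rcons_pair/=.
case: ltnP => [ik|ki].
  by rewrite (nth_map (Ordinal ik)) ?size_enum_ord// nth_enum_ord.
by congr nth; apply/eqP; rewrite eqn_leq ki -ltnS ltn_ord.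
Qed.

Lemma measurable_first_coords p k :
  measurable_fun setT (fun x : p.-tuple R => first_coords k x).
Proof.
apply/measurable_fun_tnthP => i.
have := @measurable_tuple_nth R p i.
by apply: eq_measurable_fun => x _; rewrite /= tnth_mktuple.
Qed.

Context d (T : measurableType d) (P : probability T R) (p : nat)
  (X : {RV P >-> p.-tuple R}).
Hypothesis Q_rcd : sequential_cond_distributions P X Q.

(** Induction on the number of coordinates: given the first [k] of them, [Q k] is the conditional
    law of the next, and inverse transform sampling produces it from a fresh uniform coordinate on
    which the earlier ones do not depend. *)
Lemma law_first_coords k (A : set (k.-tuple R)) : (k <= p)%N -> measurable A ->
  P [set w | A (first_coords k (X w))] =
  uniform_cube R k [set u | A (quantile_transform Q u k)].
Proof.
elim: k A => [|k IH] A kp mA.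
  have A0 : A = set0 \/ A = setT.
    have [A0|A0] := pselect (A [tuple]); [right|left]; apply/seteqP;
      split => // x; by rewrite (tuple0 x).
  case: A0 => ->; first by rewrite /= !measure0.
  by transitivity (1%E : \bar R); [exact:
    probability_setT|exact/esym/probability_setT].
pose Xk := mfun_of (measurableT_comp (@measurable_first_coords p k)
  (measurable_funP X)).
pose Xk' := mfun_of (measurableT_comp (@measurable_tuple_nth R p k)
  (measurable_funP X)).
pose B := [set z : k.-tuple R * R | A (rcons_pair z)].
have mB : measurable B by apply: measurable_preimage mA;
  exact: measurable_rcons_pair.
transitivity (P [set w | B (Xk w, Xk' w)]).
  by congr (P _); apply/seteqP; split => w /=; rewrite /B/= first_coordsS.
rewrite (@regular_cond_distributionE _ _ _ _ _ _ _ P Xk' Xk (Q k))//;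
  last exact: Q_rcd.
set g := fun x => Q k x (xsection B x).
have mg : measurable_fun setT g by exact: measurable_kernel_xsection.
pose qt := mfun_of (@measurable_quantile_transform k k).
transitivity (\int[pushforward P Xk]_x g x)%E.
  by rewrite ge0_integral_pushforward.
rewrite uniform_cube_rcons; last first.
  by apply: measurable_preimage mA; exact: measurable_quantile_transform.
rewrite (eq_measure_integral (pushforward (uniform_cube R k) qt)); last first.
  by move=> C mC _; exact: IH (ltnW kp) mC.
rewrite ge0_integral_pushforward//.
apply: eq_integral => u _; rewrite /= /g.
rewrite -unif01_quantile; first last.
- exact: measurable_xsection.
- exact: prob_kernel.
have qtE b : quantile_transform Q (rcons u b) k = quantile_transform Q u k.
  by apply: eq_quantile_transform => i ik; rewrite nth_rcons size_tuple ik.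
have nthE b : (rcons u b)`_k = b by rewrite nth_rcons size_tuple ltnn eqxx.
by congr (unif01 _); apply/seteqP; split => b /=;
  rewrite xsectionE/= /B/= qtE nthE.
Qed.

Lemma law_quantile_transform (A : set (p.-tuple R)) : measurable A ->
  lebesgue_tuple (@open_cube R p `&` [set u | A (quantile_transform Q u p)]) =
  P (X @^-1` A).
Proof.
move=> mA; rewrite lebesgue_tuple_cube; last first.
  by apply: measurable_preimage mA; exact: measurable_quantile_transform.
rewrite -law_first_coords//; congr (P _); apply/seteqP; split => w /=;
  rewrite (_ : first_coords p (X w) = X w)//; apply: eq_from_tnth => i;
  by rewrite tnth_mktuple (tnth_nth 0).
Qed.
End quantile_transform.

(** * Convex order and stop-loss transforms *)

Section bounded_measurable.
Context d (T : measurableType d) (R : realType) (P : probability T R).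
Implicit Types f g : T -> R.

(** A class of integrable functions closed under the operations used below, so that integrability
    conditions become structural goals. *)
Definition bounded_measurable f :=
  measurable_fun setT f /\ exists M, forall w, `|f w| <= M.

Lemma bounded_measurable_integrable f :
  bounded_measurable f -> P.-integrable setT (EFin \o f).
Proof.
move=> [mf [M fM]]; apply: measurable_bounded_integrable => //.
  by apply: (le_lt_trans (probability_le1 P measurableT)); exact: ltry.
exists M; split; first exact: num_real.
by move=> x Mx w _; apply: le_trans (fM w) (ltW Mx).
Qed.

Lemma bounded_measurableD f g : bounded_measurable f -> bounded_measurable g ->
  bounded_measurable (fun w => f w + g w).
Proof.
move=> [mf [M fM]] [mg [N gN]]; split; first exact: measurable_funD.
by exists (M + N) => w; apply: le_trans (ler_normD _ _) _; exact: lerD.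
Qed.

Lemma bounded_measurableM f g : bounded_measurable f -> bounded_measurable g ->
  bounded_measurable (fun w => f w * g w).
Proof.
move=> [mf [M fM]] [mg [N gN]]; split; first exact: measurable_funM.
by exists (M * N) => w; rewrite normrM ler_pM.
Qed.

Lemma bounded_measurable_cst c : bounded_measurable (fun=> c).
Proof. by split; [exact: measurable_cst|exists `|c|]. Qed.

Lemma bounded_measurableN f : bounded_measurable f ->
  bounded_measurable (fun w => - f w).
Proof.
move=> [mf [M fM]]; split; first exact: measurableT_comp.
by exists M => w; rewrite normrN.
Qed.

Lemma bounded_measurableB f g : bounded_measurable f -> bounded_measurable g ->
  bounded_measurable (fun w => f w - g w).
Proof. by move=> bf bg; exact/(bounded_measurableD bf)/bounded_measurableN. Qed.

Lemma bounded_measurable_max0 f : bounded_measurable f ->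
  bounded_measurable (fun w => Num.max (f w) 0).
Proof.
move=> [mf [M fM]]; split.
  by apply: measurable_maxr => //; exact: measurable_cst.
exists M => w; apply: le_trans (fM w).
by case: (leP (f w) 0) => fw; rewrite ?normr0.
Qed.

Lemma bounded_measurable_indic (D : set T) : measurable D ->
  bounded_measurable (\1_D : T -> R).
Proof.
move=> mD; split; first exact: measurable_indic.
by exists 1 => w; rewrite indicE; case: (_ \in _); rewrite ?normr0 ?normr1.
Qed.

Lemma bounded_measurable01 f : measurable_fun setT f -> (forall w, 0 <= f w <= 1) ->
  bounded_measurable f.
Proof.
move=> mf f01; split => //; exists 1 => w; have /andP[f0 f1] := f01 w.
by rewrite ger0_norm.
Qed.

Lemma expectation_Rintegral f : bounded_measurable f ->
  ('E_P[f] = (\int[P]_w f w)%:E)%E.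
Proof.
move=> bf; rewrite unlock fineK//.
exact: integrable_fin_num (bounded_measurable_integrable bf).
Qed.

Lemma RintegralDb f g : bounded_measurable f -> bounded_measurable g ->
  \int[P]_w (f w + g w) = \int[P]_w f w + \int[P]_w g w.
Proof. by move=> bf bg; apply: RintegralD => //;
  exact: bounded_measurable_integrable. Qed.

Lemma RintegralBb f g : bounded_measurable f -> bounded_measurable g ->
  \int[P]_w (f w - g w) = \int[P]_w f w - \int[P]_w g w.
Proof. by move=> bf bg; apply: RintegralB => //;
  exact: bounded_measurable_integrable. Qed.

Lemma RintegralZb c f : bounded_measurable f ->
  \int[P]_w (c * f w) = c * \int[P]_w f w.
Proof. by move=> bf; apply: RintegralZl => //; exact:
  bounded_measurable_integrable. Qed.

Lemma Rintegral_cstb c : \int[P]_w c = c.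
Proof. rewrite Rintegral_cst// -[RHS]mulr1; congr (_ * _).
exact: (congr1 fine (probability_setT P)). Qed.

Lemma le_Rintegralb f g : bounded_measurable f -> bounded_measurable g ->
  (forall w, f w <= g w) -> \int[P]_w f w <= \int[P]_w g w.
Proof.
by move=> bf bg fg; apply: le_Rintegral => //; exact: bounded_measurable_integrable.
Qed.

Lemma Rintegral_indicb (D : set T) : measurable D ->
  \int[P]_w (\1_D w : R) = fine (P D).
Proof. by move=> mD; rewrite /Rintegral integral_indic// setIT. Qed.

End bounded_measurable.

Section convex_real_function.
Context (R : realType) (phi : R -> R).
Hypothesis phi_convex : convex_function (E := R^o) setT phi.

Lemma convex_le_chord a b x : a < b -> a <= x <= b ->
  phi x * (b - a) <= phi a * (b - x) + phi b * (x - a).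
Proof.
move=> ab /andP[ax xb]; have ba : 0 < b - a by rewrite subr_gt0.
have t0 : 0 <= (b - x) / (b - a) by rewrite divr_ge0 ?subr_ge0// ltW.
have t1 : (b - x) / (b - a) <= 1 by rewrite ler_pdivrMr// mul1r lerD2l lerN2.
set l := (b - x) / (b - a) in t0 t1.
have H : phi (l * a + (1 - l) * b) <= l * phi a + (1 - l) * phi b.
  exact: (@phi_convex (Itv01 t0 t1) a b (in_setT _) (in_setT _)).
move: H; have -> : l * a + (1 - l) * b = x.
  by rewrite /l; field; rewrite gt_eqF.
rewrite -(ler_pM2r ba) => /le_trans; apply.
by rewrite le_eqVlt; apply/orP; left; apply/eqP; rewrite /l; field; rewrite gt_eqF.
Qed.

Lemma convex_slope_le a b c : a < b -> b < c ->
  (phi b - phi a) / (b - a) <= (phi c - phi b) / (c - b).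
Proof.
move=> ab bc; have := @convex_le_chord a c b (lt_trans ab bc).
rewrite (ltW ab) (ltW bc) => /(_ isT) H.
rewrite ler_pdivrMr ?subr_gt0// mulrAC ler_pdivlMr ?subr_gt0//.
nra.
Qed.

(** Strict sublevel sets of a convex function are intervals. *)
Lemma convex_measurable : measurable_fun setT phi.
Proof.
apply: (measurability (@RGenInftyO.G R)); first exact: RGenInftyO.measurableE.
move=> _ [_ [y ->] <-]; rewrite setTI; apply: is_interval_measurable.
move=> a b /=; rewrite !in_itv/= => ay bY z /andP[az zb].
have [ab|ba] := ltP a b; last first.
  by rewrite (_ : z = a)//; apply/le_anti; rewrite az (le_trans zb ba).
have := @convex_le_chord a b z ab; rewrite az zb => /(_ isT) H.
rewrite in_itv/= -(ltr_pM2r (_ : 0 < b - a)) ?subr_gt0//.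
apply: le_lt_trans H _.
have [z1|z1] := ltP z b; nra.
Qed.

(** The upper bound is the chord over [0,1]. The lower bound comes from the chord over [-1,x] read
    at 0: phi(x) >= (1 + x) phi(0) - x phi(-1). *)
Lemma convex_bounded01 x : 0 <= x <= 1 ->
  `|phi x| <= 2 * `|phi 0| + `|phi 1| + `|phi (-1)|.
Proof.
move=> /andP[x0 x1].
have := @convex_le_chord 0 1 x ltr01; rewrite x0 x1 => /(_ isT) H1.
have xN1 : -1 < x by lra.
have := @convex_le_chord (-1) x 0 xN1; rewrite x0 andbT lerN10 => /(_ isT) H2.
have := ler_norm (phi 0); have := ler_norm (phi 1); have := ler_norm (phi (-1)).
have := normr_ge0 (phi (-1)); have := normr_ge0 (phi 1); have := normr_ge0 (phi 0).
have := ler_norm (- phi 0); have := ler_norm (- phi 1);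
  have := ler_norm (- phi (-1)).
rewrite !normrN ler_norml => ? ? ? ? ? ? ? ? ?; apply/andP; split; nra.
Qed.
End convex_real_function.
Lemma convex_function_real (R : realType) (phi : R -> R) :
  (forall l x y, 0 <= l <= 1 -> phi (l * x + (1 - l) * y) <= l * phi x + (1 -
    l) * phi y) ->
  convex_function (E := R^o) setT phi.
Proof.
move=> H t x y _ _; apply: H; apply/andP; split; [exact: ge0|exact: le1].
Qed.

Section convex_order.
Context d (T : measurableType d) (R : realType) (P : probability T R).

Definition stop_loss (S : T -> R) (c : R) := \int[P]_w Num.max (S w - c) 0.

(** For variables with values in [0,1], thresholds outside [0,1] add nothing: below 0 the hinge is
    affine on the range, so equal means suffice, and above 1 it vanishes there. *)
Definition stop_loss_le (S S' : T -> R) :=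
  \int[P]_w S w = \int[P]_w S' w /\
  forall c, 0 <= c <= 1 -> stop_loss S c <= stop_loss S' c.

Lemma stop_loss0 S : (forall w, 0 <= S w) -> stop_loss S 0 = \int[P]_w S w.
Proof. by move=> S0; apply: eq_Rintegral => w _; rewrite subr0 max_l. Qed.

Lemma stop_loss1 S : (forall w, S w <= 1) -> stop_loss S 1 = 0.
Proof.
move=> S1; rewrite -[RHS](Rintegral_cstb P); apply: eq_Rintegral => w _.
by rewrite max_r// subr_le0.
Qed.

Context (S S' : T -> R).
Hypotheses (mS : measurable_fun setT S) (S01 : forall w, 0 <= S w <= 1).
Hypotheses (mS' : measurable_fun setT S') (S'01 : forall w, 0 <= S' w <= 1).

Let bS : bounded_measurable S. Proof. exact: bounded_measurable01. Qed.
Let bS' : bounded_measurable S'. Proof. exact: bounded_measurable01. Qed.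

Section piecewise_linear.
Context (phi : R -> R) (phi_convex : convex_function (E := R^o) setT phi).
Hypothesis SS' : stop_loss_le S S'.

Let slope h a := (phi (a + h) - phi a) / h.

Let slopeE h a : 0 < h -> phi (a + h) = phi a + slope h a * h.
Proof. by move=> h0; rewrite /slope divfK ?gt_eqF// [RHS]addrC subrK. Qed.

(** By convexity, slopes over subintervals of [-1,1] lie between the slopes over [-2,-1] and over
    [1,2]; [C] is the gap. The range starts at -1 because the chord preceding a node [a >= 0] starts
    at [a - h >= -1]. *)
Let C := (phi 2 - phi 1) - (phi (-1) - phi (-2)).

Let slope_step h a : 0 < h <= 1 -> 0 <= a -> a + h <= 1 -> slope h a - slope h
  (a - h) <= C.
Proof.
move=> /andP[h0 h1] a0 ah1.
have le1 : slope h a <= phi 2 - phi 1.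
  have s1 : (phi 2 - phi 1) / (2 - 1) = phi 2 - phi 1 by field.
  (* [convex_slope_le] compares adjacent intervals only, so [a,a+h] and [1,2] are linked through
     [a+h,1], which degenerates when a + h = 1. *)
  have [E|N] := eqVneq (a + h) 1.
    rewrite /slope E -s1 (_ : h = 1 - a); last by lra.
    by apply: convex_slope_le => //; lra.
  have lt : a + h < 1 by rewrite lt_neqAle N.
  rewrite /slope -[X in _ / X](addrK a) [X in _ / (X - _)]addrC.
  apply: (le_trans (convex_slope_le phi_convex _ lt)); first by lra.
  by rewrite -s1; apply: convex_slope_le => //; lra.
have le2 : phi (-1) - phi (-2) <= slope h (a - h).
  have s1 : (phi (-1) - phi (-2)) / (-1 - -2) = phi (-1) - phi (-2) by field.
  rewrite /slope subrK -[X in _ / X](_ : a - (a - h) = h); last by lra.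
  have [E|N] := eqVneq (a - h) (-1).
    by rewrite E -s1; apply: convex_slope_le => //; lra.
  have lt : -1 < a - h by rewrite lt_neqAle eq_sym N/=; lra.
  rewrite -s1; apply: (le_trans (convex_slope_le phi_convex _ lt)); first by lra.
  by apply: convex_slope_le => //; lra.
rewrite /C; lra.
Qed.

(** The chord over [a,a+h] lies above [phi]. The preceding chord, prolonged beyond [a], lies below
    it, so the error is at most the jump of slope times x - a. *)
Let segment h a x : 0 < h <= 1 -> 0 <= a -> a + h <= 1 -> a <= x <= a + h ->
  phi x <= phi a + slope h a * (x - a) <= phi x + C * h.
Proof.
move=> h01 a0 ah1 /andP[ax xh]; have /andP[h0 h1] := h01; apply/andP; split.
  have := @convex_le_chord _ _ phi_convex a (a + h) x;
    rewrite ltrDl h0 ax xh => /(_ isT isT) H.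
  rewrite slopeE// in H; rewrite -(ler_pM2r h0).
  move: (slope h a) H => s H; lra.
have st := slope_step h01 a0 ah1.
have low : phi a + slope h (a - h) * (x - a) <= phi x.
  have [xa|xa] := ltP a x; last by rewrite (_ : x = a) ?subrr ?mulr0 ?addr0//; lra.
  have aha : a - h < a by lra.
  have := convex_slope_le phi_convex aha xa.
  rewrite ler_pdivlMr ?subr_gt0// /slope subrK (_ : a - (a - h) = h); last by lra.
  lra.
have C0 : slope h a - slope h (a - h) >= 0.
  have aha : a - h < a by lra.
  have aah : a < a + h by lra.
  have := convex_slope_le phi_convex aha aah.
  rewrite /slope subrK opprB addrCA subrr addr0 addrAC subrr add0r subr_ge0.
  exact.
nra.
Qed.

(* [psi] interpolates [phi] linearly at the points j / (m + 1) with j <= k + 1;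
   it is an affine function plus nonnegative multiples of hinges. *)
Let approx m k : (k <= m)%N -> let h := m.+1%:R^-1 in
  exists psi : R -> R, [/\ bounded_measurable (psi \o S),
    bounded_measurable (psi \o S'),
    \int[P]_w psi (S w) <= \int[P]_w psi (S' w),
    (forall x, k%:R * h <= x ->
      psi x = phi (k%:R * h) + slope h (k%:R * h) * (x - k%:R * h)) &
    (forall x, 0 <= x <= k.+1%:R * h -> phi x <= psi x <= phi x + C * h)].
Proof.
move=> + h.
have h0 : 0 < h by rewrite invr_gt0.
have h1 : h <= 1 by rewrite invf_le1// ler1n.
have kh j : (j <= m.+1)%N -> j%:R * h <= 1.
  by move=> jm; rewrite ler_pdivrMr// mul1r ler_nat.
have j0 j : 0 <= j%:R * h by rewrite mulr_ge0// ltW.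
have jS j : j.+1%:R * h = j%:R * h + h by rewrite -natr1 mulrDl mul1r.
have [ES SL] := SS'.
clearbody h; elim: k => [_|k IH km].
  have ba f : bounded_measurable f ->
      bounded_measurable (fun w : T => phi 0 + slope h 0 * f w).
    move=> bf; apply: bounded_measurableD; first exact: bounded_measurable_cst.
    by apply: bounded_measurableM => //; exact: bounded_measurable_cst.
  exists (fun x => phi 0 + slope h 0 * x); split.
  - exact: ba.
  - exact: ba.
  (* The initial slope may have either sign, so the base case rests on the equality of means. *)
  - have bc c := @bounded_measurable_cst _ T R c.
    rewrite !RintegralDb//; last 2 first.
      by apply: bounded_measurableM.
      by apply: bounded_measurableM.
    by rewrite !RintegralZb// ES.
  - by move=> x _; rewrite mul0r subr0.
  - move=> x; rewrite mul1r => x0h.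
    by have := @segment h 0 x; rewrite h0 h1 lexx add0r h1 x0h subr0; apply.
have [psi [bp bp' pp ptail papp]] := IH (ltnW km).
have ab : k.+1%:R * h = k%:R * h + h by rewrite jS.
have b01 : 0 <= k.+1%:R * h <= 1 by rewrite j0 kh// ltnW.
have bh1 : k.+1%:R * h + h <= 1 by rewrite -jS kh.
have bS2 : k.+2%:R * h = k.+1%:R * h + h by rewrite jS.
rewrite {}bS2; move: ab b01 bh1 ptail papp.
move: (k.+1%:R * h) (k%:R * h) => b a ab b01 bh1 ptail papp.
(* The jump of slope at the node [b]: adding [s] times the hinge at [b] continues the interpolation
   along the next chord. Convexity gives [s >= 0], hence the stop-loss inequality at [b] can be
   added. *)
have [s sE] : exists s, s = slope h b - slope h a by eexists.
have s0 : 0 <= s.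
  rewrite sE subr_ge0 /slope ab.
  have aha : a < a + h by rewrite ltrDl.
  have aah : a + h < a + h + h by rewrite ltrDl.
  by have := convex_slope_le phi_convex aha aah;
    rewrite addrAC subrr add0r [a + h + h]addrC addrK.
have bhinge f : bounded_measurable f -> bounded_measurable (fun w : T =>
  Num.max (f w - b) 0).
  move=> bf; apply: bounded_measurable_max0; apply: bounded_measurableB => //.
  exact: bounded_measurable_cst.
have bshinge f : bounded_measurable f -> bounded_measurable (fun w : T => s *
  Num.max (f w - b) 0).
  by move=> bf; apply: bounded_measurableM; [exact:
    bounded_measurable_cst|exact: bhinge].
exists (fun x => psi x + s * Num.max (x - b) 0); split.
- by apply: bounded_measurableD => //; exact: bshinge.
- by apply: bounded_measurableD => //; exact: bshinge.
- rewrite !RintegralDb//; try exact: bshinge.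
  by rewrite !RintegralZb ?lerD// ?ler_wpM2l//; try exact: bhinge; exact: SL.
- move=> x bx; rewrite ptail; last by rewrite (le_trans _ bx)// ab lerDl ltW.
  rewrite max_l ?subr_ge0//.
  have -> : phi b = phi a + slope h a * h by rewrite ab slopeE.
  rewrite sE ab; lra.
- move=> x /andP[x0 xb]; have [xlb|bx] := leP x b.
    rewrite max_r ?subr_le0// mulr0 addr0; apply: papp.
    by rewrite x0.
  rewrite ptail; last by rewrite (le_trans _ (ltW bx))// ab lerDl ltW.
  rewrite max_l ?subr_ge0 ?(ltW bx)//.
  have := @segment h b x; rewrite h0 h1 (andP b01).1 bh1 (ltW bx) xb => /(_ isT
    isT isT isT).
  have -> : phi b = phi a + slope h a * h by rewrite ab slopeE.
  suff -> : phi a + slope h a * h + slope h b * (x - b) =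
    phi a + slope h a * (x - a) + s * (x - b) by [].
  rewrite sE ab; lra.
Qed.

Lemma stop_loss_le_convex : 
  \int[P]_w phi (S w) <= \int[P]_w phi (S' w).
Proof.
have bphi (f : T -> R) : measurable_fun setT f -> (forall w : T, 0 <= f w <= 1) ->
    bounded_measurable (fun w => phi (f w)).
  move=> mf f01; split.
    exact: measurableT_comp (convex_measurable phi_convex) mf.
  by eexists => w; exact: convex_bounded01 phi_convex _ (f01 w).
apply/ler_addgt0Pr => e e0.
have [m Cm] : exists m, C * m.+1%:R^-1 <= e.
  exists (Num.truncn `|C / e|).
  rewrite ler_pdivrMr// mulrC -ler_pdivrMr//; apply: le_trans (ler_norm _) _.
  exact: ltW (truncnS_gt _).
have [psi [bp bp' pp _ papp]] := approx (leqnn m).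
(* At the last index k = m the interpolation range is all of [0,1]. *)
move: papp; rewrite divff ?pnatr_eq0// => papp.
have bS1 := bphi _ mS S01; have bS1' := bphi _ mS' S'01.
apply: (@le_trans _ _ (\int[P]_w psi (S w))).
  by apply: le_Rintegralb => // w; case/andP: (papp _ (S01 w)).
apply: (le_trans pp).
rewrite -[X in _ + X](Rintegral_cstb P) -RintegralDb//;
  last exact: bounded_measurable_cst.
apply: le_Rintegralb => //.
  by apply: bounded_measurableD => //; exact: bounded_measurable_cst.
move=> w; case/andP: (papp _ (S'01 w)) => _ /le_trans; apply.
by rewrite lerD2l.
Qed.

End piecewise_linear.

(** One direction tests against the identity, its opposite and the hinges, all of them convex; the
    other is the interpolation argument. *)
Lemma convex_orderP : convex_order P S S' <-> stop_loss_le S S'.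
Proof.
have bphi phi : convex_function (E := R^o) setT phi ->
    bounded_measurable (phi \o S) /\ bounded_measurable (phi \o S').
  move=> cphi; split; split; try by eexists => w; apply: convex_bounded01.
    exact: measurableT_comp (convex_measurable cphi) mS.
  exact: measurableT_comp (convex_measurable cphi) mS'.
split=> [SS'|SS' phi cphi]; last first.
  have [b b'] := bphi _ cphi.
  by rewrite !expectation_Rintegral// lee_fin; exact: stop_loss_le_convex.
have SSphi phi : convex_function (E := R^o) setT phi ->
    \int[P]_w phi (S w) <= \int[P]_w phi (S' w).
  move=> cphi; have [b b'] := bphi _ cphi.
  by have := SS' phi cphi; rewrite !expectation_Rintegral// lee_fin.
split.
  apply/le_anti/andP; split.
    by apply: (SSphi id); apply: convex_function_real.
  have bN f : bounded_measurable f -> \int[P]_w (- f w) = - \int[P]_w f w.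
    move=> bf; rewrite -[RHS]mulN1r -RintegralZb//.
    by apply: eq_Rintegral => w _; rewrite mulN1r.
  rewrite -lerN2 -!bN//; apply: (SSphi -%R); apply: convex_function_real.
  by move=> l x y _; lra.
move=> c _; apply: (SSphi (fun x => Num.max (x - c) 0)).
apply: convex_function_real => l x y /andP[l0 l1].
rewrite ge_max; apply/andP; split; last first.
  by rewrite addr_ge0// mulr_ge0// ?subr_ge0// le_max lexx orbT.
have : x - c <= Num.max (x - c) 0 by rewrite le_max lexx.
have : y - c <= Num.max (y - c) 0 by rewrite le_max lexx.
nra.
Qed.

End convex_order.

(** * Duality between stop-loss transforms and tail expectations *)

Section stop_loss_tail.
Context d (T : measurableType d) (R : realType) (P : probability T R).
Context (U : {RV P >-> R}) (U_unif : uniform01 U).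

Definition tail_expectation (S : T -> R) (t : R) :=
  \int[P]_w (\1_[set w | t < U w] w * S w).

Let mUt t : measurable [set w | t < U w].
Proof.
rewrite (_ : [set w | _] = U @^-1` `]t, +oo[); last first.
  by apply/seteqP; split => w /=; rewrite in_itv/= andbT.
exact: measurable_funPTI.
Qed.

(** Where [U] leaves (0,1) or equals [t], monotonicity gives no comparison of g(U) with a separating
    level. *)
Let null t := U @^-1` (~` `]0, 1[ `|` [set t]).

Let null_measurable t : measurable (null t).
Proof.
by apply: measurable_funPTI; apply: measurableU => //; exact: measurableC.
Qed.

Let null_integral t : \int[P]_w \1_(null t) w = 0.
Proof.
rewrite Rintegral_indicb// /null.
have mN : measurable (~` `]0%R, 1%R[ `|` [set t]).
  by apply: measurableU => //; exact: measurableC.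
rewrite (_ : P _ = distribution P U (~` `]0%R, 1%R[ `|` [set t]))// U_unif//.
rewrite uniform01_probE// setIUr setICr set0U.
suff -> : lebesgue_measure (`]0%R, 1%R[%classic `&` [set t]) = 0%E by [].
apply/eqP; rewrite -measure_le0 -(lebesgue_measure_set1 t).
by apply: le_measure; rewrite ?inE//; exact: measurableI.
Qed.

Let bUt t : bounded_measurable (\1_[set w | t < U w] : T -> R).
Proof. exact: bounded_measurable_indic. Qed.

Section one_function.
Context (g : R -> R).
Hypotheses (mg : measurable_fun setT (g \o U)) (g01 : forall u, 0 <= g u <= 1).
Hypothesis (g_nd : {in `]0, 1[ &, {homo g : u v / u <= v}}).

Let bg : bounded_measurable (g \o U).
Proof. by apply: bounded_measurable01 => // w; exact: g01. Qed.

Let bg1 t : bounded_measurable (fun w => \1_[set w | t < U w] w * (g \o U) w).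
Proof. exact: bounded_measurableM. Qed.

Let bgc t c : bounded_measurable (fun w => \1_[set w | t < U w] w * (g (U w) - c)).
Proof.
apply: bounded_measurableM => //; apply: bounded_measurableB => //.
exact: bounded_measurable_cst.
Qed.

Let bmax c : bounded_measurable (fun w => Num.max (g (U w) - c) 0).
Proof.
apply: bounded_measurable_max0; apply: bounded_measurableB => //.
exact: bounded_measurable_cst.
Qed.

Let tailE t c : tail_expectation (g \o U) t =
  c * fine (P [set w | t < U w]) + \int[P]_w (\1_[set w | t < U w] w * (g (U w)
    - c)).
Proof.
rewrite -Rintegral_indicb// -RintegralZb// -RintegralDb//; last first.
  by apply: bounded_measurableM => //; exact: bounded_measurable_cst.
by apply: eq_Rintegral => w _ /=; rewrite mulrBr [c * _]mulrC addrCA subrr addr0.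
Qed.

(** For any event, its indicator times g(U) - c is at most the positive part of g(U) - c. *)
Lemma tail_le_stop_loss t c : tail_expectation (g \o U) t <=
  c * fine (P [set w | t < U w]) + stop_loss P (g \o U) c.
Proof.
rewrite (tailE t c) lerD2l; apply: le_Rintegralb => // w.
rewrite indicE; case: (_ \in _); rewrite ?mul1r ?mul0r le_max lexx ?orbT//.
Qed.

(** The equality case: if [c] separates the values of [g] on the two sides of [t], then U > t
    selects the positive part of g(U) - c, up to a null set. *)
Lemma stop_loss_le_tail t c : 0 <= c <= 1 ->
  (forall u, 0 < u < 1 -> t < u -> c <= g u) ->
  (forall u, 0 < u < 1 -> u < t -> g u <= c) ->
  c * fine (P [set w | t < U w]) + stop_loss P (g \o U) c <=
  tail_expectation (g \o U) t.
Proof.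
move=> c01 gt_t lt_t; rewrite (tailE t c) lerD2l.
(* On the exceptional set the positive part is at most 1 and the product with the indicator at least
   -1, so a correction of 2 restores the pointwise inequality; its integral is zero. *)
have bN : bounded_measurable (fun w => 2 * \1_(null t) w : R).
  apply: bounded_measurableM; first exact: bounded_measurable_cst.
  exact: bounded_measurable_indic.
rewrite -[leRHS]addr0 -[X in _ + X](mulr0 2) -(null_integral t) -RintegralZb;
  last first.
  exact: bounded_measurable_indic.
rewrite -RintegralDb//; apply: le_Rintegralb => //.
  exact: bounded_measurableD.
move=> w; rewrite !indicE /=.
have /andP[gU0 gU1] := g01 (U w); have /andP[c0 c1] := c01.
have [wN|wN] := boolP (w \in null t).
  case: (_ \in _); rewrite /= ?mul1r ?mul0r ?mulr1 ge_max; lra.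
have {}wN : 0 < U w < 1 /\ U w != t.
  move: wN; rewrite notin_setE /null/= => /not_orP[/contrapT + /eqP].
  by rewrite in_itv.
rewrite mulr0 addr0; case: wN => U01 Ut.
have [tU|Ut'|E] := ltgtP t (U w); last by rewrite E eqxx in Ut.
  by rewrite mem_set//= mul1r max_l// subr_ge0 gt_t.
rewrite memNset/=; last by apply/negP; rewrite -leNgt ltW.
by rewrite mul0r max_r// subr_le0 lt_t.
Qed.

Lemma tail_expectation0 : tail_expectation (g \o U) 0 = \int[P]_w g (U w).
Proof.
have -> : \int[P]_w g (U w) = 0 * fine (P [set w | 0 < U w]) + stop_loss P (g
  \o U) 0.
  by rewrite mul0r add0r stop_loss0// => w; case/andP: (g01 (U w)).
apply/le_anti/andP; split; first exact: tail_le_stop_loss.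
apply: stop_loss_le_tail; rewrite ?lexx ?ler01// => u.
  by move=> _ _; case/andP: (g01 u).
by move=> /andP[u0 _] /(lt_trans u0); rewrite ltxx.
Qed.

(** [t] is the infimum of the points where [g] exceeds [c]; the point 1 is added so that the set is
    never empty. *)
Lemma stop_loss_threshold c : exists t,
  [/\ 0 <= t <= 1, (forall u, 0 < u < 1 -> t < u -> c <= g u) &
  (forall u, 0 < u < 1 -> u < t -> g u <= c)].
Proof.
pose A := [set u | u = 1 \/ (0 < u < 1 /\ c < g u)].
have A1 : A 1 by left.
have lbA : lbound A 0 by move=> u [->|[/andP[/ltW]]].
have hA : has_inf A by split; [exists 1|exists 0].
exists (inf A); split.
- by rewrite lb_le_inf//=; [apply: ge_inf => //; exists 0|exists 1].
- move=> u u01 /(inf_lt hA.1)[v [->|[v01 cv]] vu].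
    by case/andP: u01 => _ /(lt_trans vu); rewrite ltxx.
  by apply: le_trans (ltW cv) _; apply: g_nd; rewrite ?in_itv//= ltW.
- move=> u u01 ut; rewrite leNgt; apply/negP => cu.
  have : inf A <= u by apply: ge_inf; [exists 0|right].
  by rewrite leNgt ut.
Qed.

(** Inside (0,1), monotonicity allows c = g(t). Elsewhere one of the two conditions is vacuous, and
    the extreme value 0 or 1 satisfies the other. *)
Lemma tail_threshold t : exists c,
  [/\ 0 <= c <= 1, (forall u, 0 < u < 1 -> t < u -> c <= g u) &
  (forall u, 0 < u < 1 -> u < t -> g u <= c)].
Proof.
have [t0|t0] := leP t 0.
  exists 0; split; rewrite ?lexx ?ler01// => u.
    by move=> _ _; case/andP: (g01 u).
  by move=> /andP[u0 _] /lt_le_trans /(_ t0) /(lt_trans u0); rewrite ltxx.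
have [t1|t1] := leP 1 t.
  exists 1; split; rewrite ?lexx ?ler01// => u.
    by move=> /andP[_ u1] tu; have := lt_trans (le_lt_trans t1 tu) u1; rewrite ltxx.
  by move=> _ _; case/andP: (g01 u).
by exists (g t); split => // u u01 tu; apply: g_nd;
  rewrite ?in_itv/= ?u01 ?t0 ?t1//; exact: ltW.
Qed.

End one_function.

Context (g g' : R -> R).
Hypotheses (mg : measurable_fun setT (g \o U)) (g01 : forall u, 0 <= g u <= 1).
Hypothesis (g_nd : {in `]0, 1[ &, {homo g : u v / u <= v}}).
Hypotheses (mg' : measurable_fun setT (g' \o U)) (g'01 : forall u, 0 <= g' u <= 1).
Hypothesis (g'_nd : {in `]0, 1[ &, {homo g' : u v / u <= v}}).

(* Legendre duality: the tail expectation at t is the minimum over c of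
   c P(U > t) + E (g(U) - c)^+, and conversely. *)
Lemma stop_loss_tail : stop_loss_le P (g \o U) (g' \o U) <->
  \int[P]_w g (U w) = \int[P]_w g' (U w) /\
  forall t, 0 <= t <= 1 ->
    tail_expectation (g \o U) t <= tail_expectation (g' \o U) t.
Proof.
split=> -[Eg gg']; split => // x x01.
  have [c [c01 cl cu]] := tail_threshold g'01 g'_nd x.
  apply: le_trans (stop_loss_le_tail mg' g'01 c01 cl cu).
  apply: le_trans (tail_le_stop_loss mg g01 x c) _.
  by rewrite lerD2l; exact: gg'.
have [t [t01 tl tu]] := stop_loss_threshold g_nd x.
rewrite -(lerD2l (x * fine (P [set w | t < U w]))).
apply: le_trans (stop_loss_le_tail mg g01 x01 tl tu) _.
apply: le_trans (gg' _ t01) _.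
exact: tail_le_stop_loss.
Qed.

End stop_loss_tail.

(** * Concordance order *)

Section joint_laws.
Context d (T : measurableType d) (R : realType) (P : probability T R).

Lemma le_probability_bigcap (E E' : (set T)^nat) :
  (forall n, measurable (E n)) -> (forall n, measurable (E' n)) ->
  nonincreasing_seq E -> nonincreasing_seq E' ->
  (forall n, (P (E n) <= P (E' n))%E) ->
  (P (\bigcap_n E n) <= P (\bigcap_n E' n))%E.
Proof.
move=> mE mE' niE niE' EE'.
have cE : P \o E @ \oo --> P (\bigcap_n E n).
  apply: nonincreasing_cvg_mu => //; last exact: bigcapT_measurable.
  exact: (le_lt_trans (probability_le1 P (mE 0%N)) (ltry _)).
have cE' : P \o E' @ \oo --> P (\bigcap_n E' n).
  apply: nonincreasing_cvg_mu => //; last exact: bigcapT_measurable.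
  exact: (le_lt_trans (probability_le1 P (mE' 0%N)) (ltry _)).
rewrite -(cvg_lim _ cE)// -(cvg_lim _ cE')//; apply: lee_lim.
- by apply/cvg_ex; eexists; exact: cE.
- by apply/cvg_ex; eexists; exact: cE'.
- by near=> n; exact: EE'.
Unshelve. all: by end_near. Qed.

Lemma le_probability_bigcup (E E' : (set T)^nat) :
  (forall n, measurable (E n)) -> (forall n, measurable (E' n)) ->
  nondecreasing_seq E -> nondecreasing_seq E' ->
  (forall n, (P (E n) <= P (E' n))%E) ->
  (P (\bigcup_n E n) <= P (\bigcup_n E' n))%E.
Proof.
move=> mE mE' niE niE' EE'.
have cE : P \o E @ \oo --> P (\bigcup_n E n).
  by apply: nondecreasing_cvg_mu => //; exact: bigcupT_measurable.
have cE' : P \o E' @ \oo --> P (\bigcup_n E' n).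
  by apply: nondecreasing_cvg_mu => //; exact: bigcupT_measurable.
rewrite -(cvg_lim _ cE)// -(cvg_lim _ cE')//; apply: lee_lim.
- by apply/cvg_ex; eexists; exact: cE.
- by apply/cvg_ex; eexists; exact: cE'.
- by near=> n; exact: EE'.
Unshelve. all: by end_near. Qed.

Lemma measurable_ge (f : T -> R) v : measurable_fun setT f -> measurable [set w
  | v <= f w].
Proof.
move=> mf; rewrite (_ : [set w | _] = [set w | `[v, +oo[%classic (f w)]).
  exact: measurable_preimage.
by apply/seteqP; split => w /=; rewrite in_itv/= andbT.
Qed.

Lemma measurable_gt (f : T -> R) v : measurable_fun setT f -> measurable [set w
  | v < f w].
Proof.
move=> mf; rewrite (_ : [set w | _] = [set w | `]v, +oo[%classic (f w)]).
  exact: measurable_preimage.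
by apply/seteqP; split => w /=; rewrite in_itv/= andbT.
Qed.

Lemma measurable_le (f : T -> R) v : measurable_fun setT f -> measurable [set w
  | f w <= v].
Proof.
move=> mf; rewrite (_ : [set w | _] = [set w | `]-oo, v]%classic (f w)]).
  exact: measurable_preimage.
by apply/seteqP; split => w /=; rewrite in_itv/=.
Qed.

(** Fixing an event for one coordinate leaves a finite measure in the other. Uniqueness from rays is
    thus applied once per coordinate, which gives equality on rectangles. *)
Lemma eq_distribution_cdf (Z Z' : T -> R * R) :
  measurable_fun setT Z -> measurable_fun setT Z' ->
  (forall s t : R, P [set w | (Z w).1 <= s /\ (Z w).2 <= t]%R =
              P [set w | (Z' w).1 <= s /\ (Z' w).2 <= t]%R) ->
  eq_distribution P Z Z'.
Proof.
move=> mZ mZ' ZZ'.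
have mfst (f : T -> R * R) : measurable_fun setT f -> measurable_fun setT (fst
  \o f).
  by move=> mf; exact: (measurableT_comp (@measurable_fst _ _ R R) mf).
have msnd (f : T -> R * R) : measurable_fun setT f -> measurable_fun setT (snd
  \o f).
  by move=> mf; exact: (measurableT_comp (@measurable_snd _ _ R R) mf).
pose Z1 := mfun_of (mfst _ mZ); pose Z1' := mfun_of (mfst _ mZ').
pose Z2 := mfun_of (msnd _ mZ); pose Z2' := mfun_of (msnd _ mZ').
have mpre (f : {mfun T >-> R}) (A : set R) : measurable A -> measurable (f @^-1` A).
  by move=> mA; exact: measurable_funPTI.
have fin (D : set T) (mD : measurable D) (f : {mfun T >-> R}) :
    (pushforward (mrestr P mD) f setT < +oo)%E.
  rewrite /pushforward preimage_setT /= /mrestr setTI.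
  exact: (le_lt_trans (probability_le1 P mD) (ltry _)).
have itvE x : [set` `]-oo, x]] = [set y : R | y <= x].
  by apply/seteqP; split => y /=; rewrite in_itv.
have step1 t A : measurable A ->
    P (Z1 @^-1` A `&` Z2 @^-1` `]-oo, t]) = P (Z1' @^-1` A `&` Z2' @^-1` `]-oo, t]).
  move=> mA.
  have mt : measurable (Z2 @^-1` `]-oo, t]) by exact: mpre.
  have mt' : measurable (Z2' @^-1` `]-oo, t]) by exact: mpre.
  apply: (@eq_measure_le_rays _ (pushforward (mrestr P mt) Z1) (pushforward
    (mrestr P mt') Z1')) => //.
    exact: fin.
  move=> s; rewrite /= /pushforward /mrestr !itvE.
  exact: ZZ'.
have step2 A B : measurable A -> measurable B ->
    P (Z1 @^-1` A `&` Z2 @^-1` B) = P (Z1' @^-1` A `&` Z2' @^-1` B).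
  move=> mA mB; rewrite setIC [in RHS]setIC.
  have mt : measurable (Z1 @^-1` A) by exact: mpre.
  have mt' : measurable (Z1' @^-1` A) by exact: mpre.
  apply: (@eq_measure_le_rays _ (pushforward (mrestr P mt) Z2) (pushforward
    (mrestr P mt') Z2')) => //.
    exact: fin.
  by move=> s; rewrite /= /pushforward /mrestr setIC [in RHS]setIC; exact: step1.
move=> A mA.
apply: (@eq_measure_rectangles _ _ R R R (pushforward P (mfun_of mZ))
  (pushforward P (mfun_of mZ'))) => //.
exact: (le_lt_trans (probability_le1 P measurableT) (ltry _)).
Qed.

Section almost_surely_uniform.
Context (V : {RV P >-> R}) (V_unif : uniform01 V).

Lemma le_probability_uniform (D D' : set T) : measurable D -> measurable D' ->
  (forall w, 0 < V w < 1 -> D w -> D' w) -> (P D <= P D')%E.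
Proof.
move=> mD mD' DD'; pose N := V @^-1` (~` `]0, 1[).
have mN : measurable N by apply: measurable_funPTI; exact: measurableC.
have N0 : P N = 0%E.
  rewrite (_ : P N = distribution P V (~` `]0%R, 1%R[))// V_unif;
    last exact: measurableC.
  by rewrite uniform01_probE; [rewrite setICr measure0|exact: measurableC].
apply: (@le_trans _ _ (P (D' `|` N))).
  apply: le_measure; rewrite ?inE//; first exact: measurableU.
  move=> w Dw; have [V01|V01] := boolP (0 < V w < 1); first by left; exact: DD'.
  by right; rewrite /N /= in_itv/=; exact/negP.
apply: (le_trans (measureU2 _ mD' mN)).
by rewrite /= N0 adde0.
Qed.

Lemma eq_probability_uniform (D D' : set T) : measurable D -> measurable D' ->
  (forall w, 0 < V w < 1 -> D w <-> D' w) -> P D = P D'.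
Proof.
move=> mD mD' DD'; apply/le_anti; rewrite !le_probability_uniform// => w V01;
  by case: (DD' _ V01).
Qed.

End almost_surely_uniform.

Section concordance.
Context (A A' B : T -> R).
Hypotheses (mA : measurable_fun setT A) (mA' : measurable_fun setT A')
  (mB : measurable_fun setT B).
Hypotheses (A01 : forall w, 0 <= A w <= 1) (A'01 : forall w, 0 <= A' w <= 1).

Let Z w := (A w, B w).
Let Z' w := (A' w, B w).

Let mZ : measurable_fun setT Z. Proof. exact: measurable_fun_pair. Qed.
Let mZ' : measurable_fun setT Z'. Proof. exact: measurable_fun_pair. Qed.

Lemma eq_distribution_concordance :
  eq_distribution P Z Z' <-> concordance_le P Z Z' /\ concordance_le P Z' Z.
Proof.
split=> [ZZ'|[c c']]; last first.
  apply: eq_distribution_cdf => // s t; apply/le_anti/andP; split.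
    exact: (c s t).1.
  exact: (c' s t).1.
have le s t : P [set w | (Z w).1 <= s /\ (Z w).2 <= t]%R =
    P [set w | (Z' w).1 <= s /\ (Z' w).2 <= t]%R.
  rewrite (_ : [set w | (Z w).1 <= s /\ (Z w).2 <= t] = Z @^-1` (`]-oo, s] `*`
    `]-oo, t])); last first.
    by apply/seteqP; split => w /=; rewrite !in_itv.
  rewrite ZZ'; last exact: measurableX.
  by congr (P _); apply/seteqP; split => w /=; rewrite !in_itv.
have gt s t : P [set w | (Z w).1 > s /\ (Z w).2 > t]%R =
    P [set w | (Z' w).1 > s /\ (Z' w).2 > t]%R.
  rewrite (_ : [set w | (Z w).1 > s /\ (Z w).2 > t] = Z @^-1` (`]s, +oo[ `*`
    `]t, +oo[)); last first.
    by apply/seteqP; split => w /=; rewrite !in_itv/= !andbT.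
  rewrite ZZ'; last exact: measurableX.
  by congr (P _); apply/seteqP; split => w /=; rewrite !in_itv/= !andbT.
by split=> s t; rewrite le gt.
Qed.

Hypothesis B_unif : uniform01 (mfun_of mB : {RV P >-> R}).

Let mge_gt (C : T -> R) (v t : R) : measurable_fun setT C -> measurable [set w
  | v <= C w /\ t < B w].
Proof.
move=> mC; have := measurableI _ _ (measurable_ge v mC) (measurable_gt t mB); exact.
Qed.

Let mgt_gt (C : T -> R) (v t : R) : measurable_fun setT C -> measurable [set w
  | v < C w /\ t < B w].
Proof.
move=> mC; have := measurableI _ _ (measurable_gt v mC) (measurable_gt t mB); exact.
Qed.

Let mle_le (C : T -> R) (v t : R) : measurable_fun setT C -> measurable [set w
  | C w <= v /\ B w <= t].
Proof.
move=> mC; have := measurableI _ _ (measurable_le v mC) (measurable_le t mB); exact.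
Qed.

(** The concordance order speaks of strict levels, the quantile formulas of closed ones: [v <= C w]
    is the decreasing limit of [v - n.+1%:R^-1 < C w]. *)
Let le_ge (C C' : T -> R) (t : R) : measurable_fun setT C -> measurable_fun
  setT C' ->
  (forall s, (P [set w | s < C w /\ t < B w]%R <= P [set w | s < C' w /\ t < B
    w]%R)%E) ->
  forall v, (P [set w | v <= C w /\ t < B w]%R <= P [set w | v <= C' w /\ t < B
    w]%R)%E.
Proof.
move=> mC mC' CC' v.
have capE (D : T -> R) : [set w | v <= D w /\ t < B w] =
    \bigcap_n [set w | v - n.+1%:R^-1 < D w /\ t < B w].
  apply/seteqP; split => w /=.
    by move=> [vD tB] n _ /=; split => //; rewrite ltrBlDr (le_lt_trans vD)//
      ltrDl invr_gt0.
  move=> H; split; last by case: (H 0%N I).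
  rewrite leNgt; apply/negP => /ltr_add_invr[n vn]; have [+ _] := H n I.
  by rewrite ltrBlDr ltNge ltW.
have ni (D : T -> R) : nonincreasing_seq (fun n => [set w | v - n.+1%:R^-1 < D
  w /\ t < B w]).
  move=> i j ij; apply/subsetPset => w /= [vD tB]; split => //.
  apply: le_lt_trans vD; rewrite lerD2l lerN2 lef_pV2 ?posrE// ler_nat//.
rewrite !capE; apply: le_probability_bigcap => // n; exact: mgt_gt.
Qed.

Lemma concordance_uniformP : concordance_le P Z Z' <->
  forall v, 0 < v < 1 ->
    P [set w | v <= A w /\ 0 < B w]%R = P [set w | v <= A' w /\ 0 < B w]%R /\
    forall t, 0 <= t <= 1 ->
     (P [set w | v <= A w /\ t < B w]%R <= P [set w | v <= A' w /\ t < B w]%R)%E.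
Proof.
have asl := le_probability_uniform B_unif.
have ase := eq_probability_uniform B_unif.
split=> [c v v01|H s t].
  split; last by move=> t _; apply: le_ge => // s; exact: (c s t).2.
  apply/le_anti/andP; split; apply: le_ge => // s; first exact: (c s 0).2.
  (* As [B] lies almost surely in (0,1), the upper orthant at level 0 is the complement of the lower
     one at level 1, which supplies the inequality in the other direction. *)
  have compl (C : T -> R) : measurable_fun setT C ->
      P [set w | s < C w /\ 0 < B w]%R = (1 - P [set w | C w <= s /\ B w <= 1]%R)%E.
    move=> mC; rewrite -probability_setC; last exact: mle_le.
    apply: ase; [exact: mgt_gt|apply: measurableC; exact: mle_le|].
    move=> w /andP[B0 B1] /=; split => [[sC _] []|].
      by rewrite leNgt sC.
    by move=> H; split => //; rewrite ltNge; apply/negP => Cs; apply: H;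
      rewrite (ltW B1).
  rewrite !compl// leeB//; exact: (c s 1).1.
have H' v t' : 0 < v < 1 ->
    (P [set w | v <= A w /\ t' < B w]%R <= P [set w | v <= A' w /\ t' < B w]%R)%E.
  move=> /H[E L]; have [t0|t0] := ltP t' 0.
    have t0E (C : T -> R) : measurable_fun setT C -> P [set w | v <= C w /\ t'
      < B w]%R =
        P [set w | v <= C w /\ 0 < B w]%R.
      move=> mC; apply: ase; [exact: mge_gt|exact: mge_gt|] => w /andP[B0 B1] /=.
      by split => -[vC _]; split => //; exact: lt_trans B0.
    by rewrite !t0E// E.
  have [t1|t1] := ltP 1 t'; last by apply: L; rewrite t0.
  apply: asl; [exact: mge_gt|exact: mge_gt|] => w /andP[B0 B1] /= [_ tB].
  by have := lt_trans (lt_trans t1 tB) B1; rewrite ltxx.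
have E' v : 0 < v < 1 -> P [set w | v <= A w /\ 0 < B w]%R = P [set w | v <= A'
  w /\ 0 < B w]%R.
  by move=> /H[].
have cup (C C' : T -> R) (t' : R) : measurable_fun setT C -> measurable_fun
  setT C' -> 0 <= s < 1 ->
  (forall v, 0 < v < 1 -> (P [set w | v <= C w /\ t' < B w]%R <= P [set w | v
    <= C' w /\ t' < B w]%R)%E) ->
  (P [set w | s < C w /\ t' < B w]%R <= P [set w | s < C' w /\ t' < B w]%R)%E.
  move=> mC mC' /andP[s0 s1] CC'.
  (* These levels decrease to [s]; the denominators start at 2 so that all of them lie strictly
     inside (0,1), even for s = 0. *)
  pose v n := s + (1 - s) / n.+2%:R.
  have v01 n : 0 < v n < 1.
    have n2 : (1 : R) < n.+2%:R by rewrite ltr1n.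
    rewrite /v -ltrBrDl ltr_pdivrMr// ltr_pMr ?subr_gt0// n2 andbT.
    by rewrite ltr_wpDl// divr_gt0// subr_gt0.
  have cupE (D : T -> R) : [set w | s < D w /\ t' < B w] = \bigcup_n [set w | v
    n <= D w /\ t' < B w].
    apply/seteqP; split => w /=.
      move=> [/[dup] + /ltr_add_invr[n sn] tB] => sD; exists n => //=; split => //.
      apply: le_trans (ltW sn); rewrite lerD2l -[leRHS]mul1r ler_pM//.
      + by rewrite subr_ge0 ltW.
      + by rewrite lerBlDr lerDl.
      + by rewrite lef_pV2 ?posrE// ler_nat.
    move=> [n _ [vD tB]]; split => //; apply: lt_le_trans vD.
    by rewrite /v ltrDl divr_gt0// subr_gt0.
  have nd (D : T -> R) : nondecreasing_seq (fun n => [set w | v n <= D w /\ t'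
    < B w]).
    move=> i j ij; apply/subsetPset => w /= [vD tB]; split => //.
    apply: le_trans vD; rewrite lerD2l ler_wpM2l ?subr_ge0 ?(ltW s1)//.
    by rewrite lef_pV2 ?posrE// ler_nat.
  rewrite !cupE; apply: le_probability_bigcup => // n.
  - exact: mge_gt.
  - exact: mge_gt.
  - exact: CC'.
(* Outside [[0, 1[] the condition on the first coordinate is always true or always false. *)
have [s0|s0] := ltP s 0.
  split.
    rewrite (_ : [set w | (Z w).1 <= s /\ _] = set0) ?measure0//.
    rewrite -subset0 => w /= [As _]; have /andP[A0 _] := A01 w.
    by have := lt_le_trans s0 (le_trans A0 As); rewrite ltxx.
  apply: le_measure; rewrite ?inE; [exact: mgt_gt|exact: mgt_gt|].
  move=> w /= [_ tB]; split => //; have /andP[A0 _] := A'01 w.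
  exact: lt_le_trans A0.
have [s1|s1] := leP 1 s.
  split.
    apply: le_measure; rewrite ?inE; [exact: mle_le|exact: mle_le|].
    move=> w /= [_ tB]; split => //; have /andP[_ A1] := A'01 w.
    exact: le_trans A1 s1.
  rewrite (_ : [set w | s < (Z w).1 /\ _] = set0) ?measure0//.
  rewrite -subset0 => w /= [As _]; have /andP[_ A1] := A01 w.
  by have := lt_le_trans As (le_trans A1 s1); rewrite ltxx.
have s01 : 0 <= s < 1 by rewrite s0.
split; last by apply: cup => // v; exact: H'.
have gt t' : (P [set w | s < A w /\ t' < B w]%R <= P [set w | s < A' w /\ t' <
  B w]%R)%E.
  by apply: cup => // v; exact: H'.
have gt0 : (P [set w | s < A' w /\ 0 < B w]%R <= P [set w | s < A w /\ 0 < B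
  w]%R)%E.
  by apply: cup => // v v01; rewrite E'.
(* Inclusion-exclusion: the two orthants differ only by margins, the one of [B] being common and
   those of [A] and [A'] equal by [gt 0] and [gt0]. *)
have split (C : T -> R) : measurable_fun setT C ->
   (P [set w | C w <= s /\ B w <= t]%R + P [set w | s < C w /\ 0 < B w]%R =
    P [set w | B w <= t]%R + P [set w | s < C w /\ t < B w]%R)%E.
  move=> mC.
  have mBt := measurable_le t mB; have mCs := measurable_le s mC;
    have mCg := measurable_gt s mC.
  rewrite (ase [set w | s < C w /\ 0 < B w] [set w | s < C w])//; last 2 first.
    exact: mgt_gt.
    by move=> w /andP[B0 _] /=; split => [[]|].
  have e1 : P [set w | B w <= t] = (P [set w | s < C w /\ B w <= t]%R + P [set
    w | C w <= s /\ B w <= t]%R)%E.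
    rewrite (measureDI P mBt mCs); congr (P _ + P _)%E; apply/seteqP; split => w /=.
    - by move=> [Bt /negP]; rewrite -ltNge.
    - by move=> [sC Bt]; split => //; apply/negP; rewrite -ltNge.
    - by move=> [].
    - by move=> [].
  have e2 : P [set w | s < C w] = (P [set w | s < C w /\ t < B w]%R + P [set w
    | s < C w /\ B w <= t]%R)%E.
    rewrite (measureDI P mCg mBt); congr (P _ + P _)%E; apply/seteqP; split => w /=.
    - by move=> [sC /negP]; rewrite -ltNge.
    - by move=> [sC tB]; split => //; apply/negP; rewrite -ltNge.
  rewrite e1 e2 [X in _ = (X + _)%E]addeC -[RHS]addeA; congr (_ + _)%E;
    exact: addeC.
have := gt t; have := le_anti (introT andP (conj (gt 0) gt0)) => e0.
rewrite -(leeD2lE (x := P [set w | B w <= t]%R)) ?fin_num_measure//;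
  last exact: measurable_le.
rewrite -!split// e0 leeD2rE// fin_num_measure//; exact: mgt_gt.
Qed.

End concordance.
End joint_laws.

(** * Conditional and rearranged quantiles *)

Lemma integral_EFinb d (T : measurableType d) (R : realType)
    (P : probability T R) (f : T -> R) : bounded_measurable f ->
  (\int[P]_w (f w)%:E = (\int[P]_w f w)%:E)%E.
Proof.
by move=> bf; rewrite fineK//; exact: integrable_fin_num
  (bounded_measurable_integrable P bf).
Qed.

Lemma measurable_df d (T : measurableType d) (R : realType)
  (P : probability T R) (Y : {RV P >-> R}) : measurable_fun setT (df Y).
Proof. by apply: nondecreasing_measurable => //; case: (is_cdf_distribution Y). Qed.

Lemma cond_survivalE d1 (T1 : measurableType d1) d (T : measurableType d)
    (R : realType) (K : R.-pker T1 ~> R) (X : T -> T1) q w :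
  cond_survival K X q w = 1 - left_limit (cond_df K (X w)) q.
Proof.
have K1 : K (X w) setT = 1%E by exact: prob_kernel.
rewrite /cond_df left_limit_measure// /cond_survival.
have fin A : measurable A -> K (X w) A \is a fin_num.
  by move=> mA; apply: lty_fin_num_fun; rewrite ?K1 ?ltry.
rewrite -setCitvl -setTD measureD//; last by rewrite -ge0_fin_numE// fin.
rewrite setTI fineB ?fin//; congr (_ - _); exact: (congr1 fine K1).
Qed.

Lemma eq_law_Rintegral d (T : measurableType d) (R : realType)
    (P : probability T R) (M N : {RV P >-> R}) :
  (forall x, P [set w | x < M w] = P [set w | x < N w]) ->
  forall f : R -> R, measurable_fun setT f -> (forall x, 0 <= f x) ->
  \int[P]_w f (M w) = \int[P]_w f (N w).
Proof.
move=> MN f mf f0.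
have itvE x : [set` `]x, +oo[] = [set y : R | x < y].
  by apply/seteqP; split => y /=; rewrite in_itv/= andbT.
have law A : measurable A -> distribution P M A = distribution P N A.
  apply: eq_measure_gt_rays; first exact: (le_lt_trans (probability_le1 _
    measurableT) (ltry _)).
  by move=> x; rewrite itvE; exact: MN.
rewrite /Rintegral; congr fine.
have mEf : measurable_fun setT (EFin \o f) by exact: measurableT_comp.
have Ef0 y : (0 <= (EFin \o f) y)%E by rewrite lee_fin.
rewrite -(@ge0_integral_distribution _ _ _ _ _ P M _ mEf Ef0).
rewrite -(@ge0_integral_distribution _ _ _ _ _ P N _ mEf Ef0).
by apply: eq_measure_integral => A mA _; exact: law.
Qed.

Section transformed_vectors.
Context d (T : measurableType d) (R : realType) (P : probability T R).
Context (U V : {RV P >-> R}) (U_unif : uniform01 U) (V_unif : uniform01 V).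
Context (Y : {RV P >-> R}).

Let q v := quantile (df Y) v.

Let df_ge v y : 0 < v < 1 -> (v <= df Y y) = (q v <= y).
Proof. by move=> v01; rewrite /q quantile_le//; exact: is_cdf_distribution. Qed.

Section conditional_quantile.
Context d1 (T1 : measurableType d1) (X : {RV P >-> T1}) (K : R.-pker T1 ~> R).
Hypothesis VX : independent_rv P V X.

Let mcond := measurable_cond_df K.
Let ccond := is_cdf_cond_df K.

Lemma measurable_cond_survival c : measurable_fun setT (cond_survival K X c).
Proof.
have := measurableT_comp (@fine_measurable R setT measurableT)
  (measurableT_comp (measurable_kernel K _ (measurable_itv `[c, +oo[))
    (measurable_funP X)).
exact.
Qed.

Lemma measurable_conditional_quantile :
  measurable_fun setT (fun w => df Y (quantile (cond_df K (X w)) (V w))).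
Proof.
have := measurableT_comp (measurable_df Y) (measurableT_comp
  (measurable_quantile ccond mcond)
  (measurable_fun_pair (measurable_funP X) (measurable_funP V))).
exact.
Qed.

Lemma prob_conditional_quantile v t : 0 < v < 1 -> 0 <= t <= 1 ->
  P [set w | v <= df Y (quantile (cond_df K (X w)) (V w)) /\ t < V w]%R =
  (\int[P]_w cond_survival K X (q v) w -
   stop_loss P (cond_survival K X (q v)) (1 - t))%:E.
Proof.
move=> v01 t01.
have S01 w : 0 <= cond_survival K X (q v) w <= 1.
  rewrite cond_survivalE; have := left_limit_itv01 (ccond (X w)) (q v); lra.
have bS : bounded_measurable (cond_survival K X (q v)).
  exact: bounded_measurable01 (measurable_cond_survival _) S01.
rewrite (_ : [set w | _] = [set w | [/\ q v <= quantile (cond_df K (X w)) (V w),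
    setT (X w) & t < V w]]); last first.
  by apply/seteqP; split => w /=; rewrite df_ge// => -[].
rewrite prob_quantile_ge// /stop_loss -RintegralBb//; last first.
  apply: bounded_measurable_max0; apply: bounded_measurableB => //.
  exact: bounded_measurable_cst.
rewrite -integral_EFinb; last first.
  apply: bounded_measurableB => //.
  apply: bounded_measurable_max0; apply: bounded_measurableB => //.
  exact: bounded_measurable_cst.
apply: eq_integral => w _; congr EFin.
(* With S = 1 - L, the identity is 1 - max(L, t) = S - max(S - (1 - t), 0). *)
rewrite indicE mem_setT mul1r cond_survivalE.
set L := left_limit _ _.
by have [Lt|tL] := leP L t; [rewrite max_l|rewrite max_r]; lra.
Qed.

End conditional_quantile.

Section rearranged.
Context (p : nat) (X : {RV P >-> p.-tuple R}) (K : R.-pker (p.-tuple R) ~> R).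
Context (Q : forall i : nat, R.-pker (i.-tuple R) ~> R) (F : R -> R -> R).
Hypotheses (VU : independent_rv P V U)
  (Q_rcd : sequential_cond_distributions P X Q)
  (F_rearr : rearranged_cond_df K Q F).

(* [F u] is only constrained for u in (0,1); outside, any distribution function
   will do. *)
Let F_ext u := F (if 0 < u < 1 then u else 2^-1).

Let half01 : 0 < (2^-1 : R) < 1.
Proof. by lra. Qed.

Let F_ext_cdf u : is_cdf (F_ext u).
Proof. by apply: F_rearr.2; rewrite /F_ext; case: ifPn. Qed.

Let F_ni y u v : 0 < u < 1 -> 0 < v < 1 -> u <= v -> F v y <= F u y.
Proof.
by move=> u01 v01 uv; have [H _] := F_rearr.1 y; apply: H; rewrite ?in_itv.
Qed.

(** On (0,1) the superlevel sets are intervals by monotonicity, and outside (0,1) the function is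
    constant, equal to its value at 1/2. *)
Let mF_ext y : measurable_fun setT (F_ext ^~ y).
Proof.
apply: (measurability (@RGenOInfty.G R)); first exact: RGenOInfty.measurableE.
move=> _ [_ [a ->] <-]; rewrite setTI.
pose I := [set u | 0 < u < 1 /\ a < F u y].
have mI : measurable I.
  apply: is_interval_measurable => u v [u01 au] [v01 av] z /andP[uz zv].
  have z01 : 0 < z < 1.
    by case/andP: u01 => u0 _; case/andP: v01 => _ v1;
      rewrite (lt_le_trans u0)//= (le_lt_trans zv).
  by split => //; apply: lt_le_trans av _; exact: F_ni.
have -> : F_ext ^~ y @^-1` `]a, +oo[ =
    I `|` (if a < F 2^-1 y then ~` `]0, 1[ else set0).
  apply/seteqP; split => u /=; rewrite in_itv/= andbT /F_ext.
    case: ifPn => u01 au; first by left.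
    by right; rewrite au/= in_itv/=; exact/negP.
  move=> [[u01 au]|]; first by rewrite u01.
  by case: ifPn => // au /=; rewrite in_itv/= => /negP/negbTE ->.
by apply: measurableU => //; case: ifPn => // _; exact: measurableC.
Qed.

Let mquant : measurable_fun setT (fun z : R * R => quantile (F_ext z.1) z.2).
Proof. exact: measurable_quantile. Qed.

Lemma measurable_rearranged :
  measurable_fun setT (fun w => df Y (rearranged_quantile F (U w) (V w))).
Proof.
have mUV := measurable_fun_pair (measurable_funP U) (measurable_funP V).
have mb : measurable_fun setT (fun w => (0 < U w) && (U w < 1)).
  by apply: measurable_and; apply: measurable_fun_ltr => //; exact: measurable_funP.
have mr : measurable_fun setT (fun w => if (0 < U w) && (U w < 1) then quantile
  (F_ext (U w)) (V w) else 0).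
  apply: measurable_fun_ifT => //.
  have := measurableT_comp mquant mUV; exact.
have rqE (u v : R) :
    (if (0 < u) && (u < 1) then quantile (F_ext u) v else 0) =
      rearranged_quantile F u v.
  rewrite /rearranged_quantile /F_ext.
  by case: ifPn => // u01; rewrite ?ifT.
have := measurableT_comp (measurable_df Y) mr.
by apply: eq_measurable_fun => w _ /=; rewrite rqE.
Qed.

(** The function g of the overview at level [v], made total through [F_ext]. *)
Definition rearranged_survival v u := 1 - left_limit (F_ext u) (q v).

Lemma rearranged_survival01 v u : 0 <= rearranged_survival v u <= 1.
Proof. by have := left_limit_itv01 (F_ext_cdf u) (q v);
  rewrite /rearranged_survival; lra. Qed.

Lemma measurable_rearranged_survival v :
  measurable_fun setT (rearranged_survival v \o U).
Proof.
have mL := measurable_left_limit F_ext_cdf mF_ext (q v).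
have := measurable_funB (@measurable_cst _ _ R R setT 1) mL.
by move=> /measurableT_comp/(_ (measurable_funP U)).
Qed.

Lemma rearranged_survival_nd v :
  {in `]0, 1[ &, {homo rearranged_survival v : u u' / u <= u'}}.
Proof.
move=> u u'; rewrite !in_itv/= => u01 u'01 uu'; rewrite lerD2l lerN2.
apply: ge_sup; first exact: (has_sup_left_limit (F_ext_cdf u') _).1.
move=> _ [y yq <-]; apply: le_trans (left_limit_ge (F_ext_cdf u) yq).
by rewrite /F_ext u01 u'01; exact: F_ni.
Qed.

Lemma prob_rearranged v t : 0 < v < 1 ->
  P [set w | v <= df Y (rearranged_quantile F (U w) (V w)) /\ t < U w]%R =
  (tail_expectation U (rearranged_survival v \o U) t)%:E.
Proof.
move=> v01.
have mqUV : measurable_fun setT (fun w => quantile (F_ext (U w)) (V w)).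
  by have := measurableT_comp mquant (measurable_fun_pair (measurable_funP U)
    (measurable_funP V)).
have mB : measurable `]t, +oo[%classic by exact: measurable_itv.
have mD2 : measurable [set w | q v <= quantile (F_ext (U w)) (V w) /\ t < U w].
  by have := measurableI _ _ (measurable_ge (q v) mqUV) (measurable_gt t
    (measurable_funP U)).
have mD3 : measurable [set w | [/\ q v <= quantile (F_ext (U w)) (V w), `]t,
  +oo[%classic (U w) & 0 < V w]].
  have := measurableI _ _ mD2 (measurable_gt 0 (measurable_funP V)).
  congr measurable; apply/seteqP; split => w /=; rewrite in_itv/= andbT.
    by move=> [[]].
  by case.
have mD1 := measurableI _ _ (measurable_ge v measurable_rearranged)
  (measurable_gt t (measurable_funP U)).
rewrite (eq_probability_uniform U_unif mD1 mD2); last first.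
  by move=> w U01 /=; rewrite df_ge// /rearranged_quantile U01 /F_ext U01.
(* The almost sure condition [0 < V w] is inserted to match the general formula for quantile events,
   with [U] as conditioning variable and threshold 0. *)
rewrite (eq_probability_uniform V_unif mD2 mD3); last first.
  move=> w /andP[V0 _] /=; rewrite in_itv/= andbT; split => [[]|[]] //.
rewrite (prob_quantile_ge V_unif VU F_ext_cdf mF_ext)// ?lexx ?ler01//.
have bg : bounded_measurable (rearranged_survival v \o U).
  by apply: bounded_measurable01; [exact: measurable_rearranged_survival|move=>
    w; exact: rearranged_survival01].
rewrite -integral_EFinb; last first.
  apply: bounded_measurableM => //; apply: bounded_measurable_indic.
  exact: measurable_gt (measurable_funP U).
apply: eq_integral => w _; congr (EFin (_ * _)).
  by rewrite !indicE; congr ((_ : bool)%:R); apply/idP/idP;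
    rewrite !inE/= in_itv/= andbT.
by rewrite /rearranged_survival/= max_l//; case/andP: (left_limit_itv01
  (F_ext_cdf (U w)) (q v)).
Qed.

Let law_F_ext y x : P [set w | x <= F_ext (U w) y] = P [set w | x <= cond_df K
  (X w) y].
Proof.
have mD : measurable [set u | x <= F_ext u y] by exact: measurable_ge.
transitivity (distribution P U [set u | x <= F_ext u y]) => //.
rewrite U_unif// uniform01_probE//.
have -> : `]0, 1[ `&` [set u | x <= F_ext u y] = `]0, 1[ `&` [set u | x <= F u y].
  by apply/seteqP; split => u /= []; rewrite in_itv/= /F_ext => u01; rewrite u01.
have [_ ->] := F_rearr.1 y.
rewrite (@law_quantile_transform R Q d T P p X Q_rcd [set z | x <= cond_df K z
  y])//.
by apply: measurable_ge; exact: measurable_cond_df.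
Qed.

Let law_left_limit c x :
  P [set w | x < left_limit (F_ext (U w)) c] =
  P [set w | x < left_limit (cond_df K (X w)) c].
Proof.
pose mf1 y := mfun_of (measurableT_comp (mF_ext y) (measurable_funP U)).
pose mf2 y := mfun_of (measurableT_comp (measurable_cond_df K y)
  (measurable_funP X)).
have geE z : [set` `[z, +oo[] = [set y : R | z <= y].
  by apply/seteqP; split => y /=; rewrite in_itv/= andbT.
have gtE z : [set` `]z, +oo[] = [set y : R | z < y].
  by apply/seteqP; split => y /=; rewrite in_itv/= andbT.
(* Closed rays determine the law, so the identity extends to open rays; only these turn the supremum
   in [left_limit] into an increasing union. *)
have law y : P [set w | x < F_ext (U w) y] = P [set w | x < cond_df K (X w) y].
  have : forall A, measurable A -> distribution P (mf1 y) A = distribution P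
    (mf2 y) A.
    apply: eq_measure_ge_rays; first exact: (le_lt_trans (probability_le1 _
      measurableT) (ltry _)).
    by move=> z; rewrite geE; exact: law_F_ext.
  by move=> /(_ `]x, +oo[%classic (measurable_itv _)); rewrite gtE.
pose E1 n := [set w | x < F_ext (U w) (c - n.+1%:R^-1)].
pose E2 n := [set w | x < cond_df K (X w) (c - n.+1%:R^-1)].
have cn i j : (i <= j)%N -> c - i.+1%:R^-1 <= c - j.+1%:R^-1.
  by move=> ij; rewrite lerD2l lerN2 lef_pV2 ?posrE// ler_nat.
have -> : [set w | x < left_limit (F_ext (U w)) c] = \bigcup_n E1 n.
  apply/seteqP; split => w /=.
    by move=> /(left_limit_gt_bigcup (F_ext_cdf _)) [n xn]; exists n.
  by move=> [n _ xn]; apply/(left_limit_gt_bigcup (F_ext_cdf _)); exists n.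
have -> : [set w | x < left_limit (cond_df K (X w)) c] = \bigcup_n E2 n.
  apply/seteqP; split => w /=.
    by move=> /(left_limit_gt_bigcup (is_cdf_cond_df K _)) [n xn]; exists n.
  by move=> [n _ xn]; apply/(left_limit_gt_bigcup (is_cdf_cond_df K _)); exists n.
have m1 n : measurable (E1 n) by exact: (measurable_gt x (measurable_funP (mf1 _))).
have m2 n : measurable (E2 n) by exact: (measurable_gt x (measurable_funP (mf2 _))).
have nd1 : nondecreasing_seq E1.
  move=> i j ij; apply/subsetPset => w /= xw; apply: lt_le_trans xw _.
  by have [Gnd _ _ _] := F_ext_cdf (U w); apply: Gnd; exact: cn.
have nd2 : nondecreasing_seq E2.
  move=> i j ij; apply/subsetPset => w /= xw; apply: lt_le_trans xw _.
  by have [Gnd _ _ _] := is_cdf_cond_df K (X w); apply: Gnd; exact: cn.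
by apply/le_anti; rewrite !le_probability_bigcup// => n; rewrite law.
Qed.

Lemma rearranged_survival_law v (f : R -> R) : measurable_fun setT f -> (forall
  x, 0 <= f x) ->
  \int[P]_w f (rearranged_survival v (U w)) =
  \int[P]_w f (cond_survival K X (q v) w).
Proof.
move=> mf f0.
have mL1 := measurableT_comp (measurable_left_limit F_ext_cdf mF_ext (q v))
  (measurable_funP U : measurable_fun setT U).
have mL2 := measurableT_comp (measurable_left_limit (is_cdf_cond_df K)
  (measurable_cond_df K) (q v))
  (measurable_funP X : measurable_fun setT X).
have mf' : measurable_fun setT (fun x : R => f (1 - x)).
  have := measurableT_comp mf (measurable_funB (@measurable_cst _ _ R R setT 1)
    (@measurable_id _ R setT)).
  exact.
have := @eq_law_Rintegral _ _ _ P (mfun_of mL1) (mfun_of mL2) (law_left_limit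
  (q v)) (fun x : R => f (1 - x)) mf' (fun x => f0 _).
move=> /= ->; apply: eq_Rintegral => w _.
by rewrite cond_survivalE.
Qed.

End rearranged.
End transformed_vectors.

(** * The equivalences with the conditional convex order *)

Lemma cond_survival_itv01 d1 (T1 : measurableType d1) d (T : measurableType d)
    (R : realType) (K : R.-pker T1 ~> R) (X : T -> T1) c w :
  0 <= cond_survival K X c w <= 1.
Proof.
rewrite cond_survivalE.
by have := left_limit_itv01 (is_cdf_cond_df K (X w)) c; lra.
Qed.

Lemma ccx_leP d (T : measurableType d) (R : realType) (P : probability T R)
    d1 (T1 : measurableType d1) d2 (T2 : measurableType d2)
    (Y : {RV P >-> R}) (X : {RV P >-> T1}) (K : R.-pker T1 ~> R)
    (Y' : {RV P >-> R}) (X' : {RV P >-> T2}) (K' : R.-pker T2 ~> R) :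
  ccx_le Y X K Y' X' K' <-> forall v, 0 < v < 1 ->
    stop_loss_le P (cond_survival K X (quantile (df Y) v))
                   (cond_survival K' X' (quantile (df Y') v)).
Proof.
have E v : convex_order P (cond_survival K X (quantile (df Y) v))
      (cond_survival K' X' (quantile (df Y') v)) <->
    stop_loss_le P (cond_survival K X (quantile (df Y) v))
      (cond_survival K' X' (quantile (df Y') v)).
  by apply: convex_orderP; [exact: measurable_cond_survival|move=> w;
    exact: cond_survival_itv01|
    exact: measurable_cond_survival|move=> w; exact: cond_survival_itv01].
by split=> H v v01; apply/E; exact: H.
Qed.

Lemma EFin_eqP (R : realType) (a b : \bar R) (x y : R) :
  a = x%:E -> b = y%:E -> a = b <-> x = y.
Proof. by move=> -> ->; split => [[]|->]. Qed.

Lemma EFin_leE (R : realType) (a b : \bar R) (x y : R) :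
  a = x%:E -> b = y%:E -> (a <= b)%E = (x <= y).
Proof. by move=> -> ->; rewrite lee_fin. Qed.

Lemma EFin_le (R : realType) (a b : \bar R) (x y : R) :
  a = x%:E -> b = y%:E -> (a <= b)%E -> x <= y.
Proof. by move=> -> ->; rewrite lee_fin. Qed.

(** The stop-loss transform enters the probability with a minus sign, which reverses the order. At t
    = 0 it is taken at threshold 1, where it vanishes and leaves the mean; other thresholds
    correspond through c = 1 - t. *)
Lemma ccx_le_conditional_quantile d (T : measurableType d) (R : realType)
    (P : probability T R) d1 (T1 : measurableType d1) d2 (T2 : measurableType d2)
    (V : {RV P >-> R}) (V_unif : uniform01 V)
    (Y : {RV P >-> R}) (X : {RV P >-> T1}) (K : R.-pker T1 ~> R)
    (Y' : {RV P >-> R}) (X' : {RV P >-> T2}) (K' : R.-pker T2 ~> R) :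
  independent_rv P V X -> independent_rv P V X' ->
  ccx_le Y X K Y' X' K' <->
  concordance_le P (fun w => (df Y' (quantile (cond_df K' (X' w)) (V w)), V w))
                   (fun w => (df Y (quantile (cond_df K (X w)) (V w)), V w)).
Proof.
have sub01 (c : R) : 0 <= c <= 1 -> 0 <= 1 - c <= 1 by lra.
have mV : measurable_fun setT V := measurable_funP V.
move=> VX VX'; rewrite ccx_leP (@concordance_uniformP _ _ _ _ _ _ _ _ _ mV);
  first last.
- exact: V_unif.
- by move=> w; apply: cdf_itv01; exact: is_cdf_distribution.
- by move=> w; apply: cdf_itv01; exact: is_cdf_distribution.
- exact: measurable_conditional_quantile.
- exact: measurable_conditional_quantile.
have S1 d0 (T0 : measurableType d0) (X0 : T -> T0) (K0 : R.-pker T0 ~> R) c :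
    stop_loss P (cond_survival K0 X0 c) 1 = 0.
  by apply: stop_loss1 => w; case/andP: (cond_survival_itv01 K0 X0 c w).
have zero01 : 0 <= (0 : R) <= 1 by rewrite lexx ler01.
have pE := prob_conditional_quantile V_unif Y K VX.
have pE' := prob_conditional_quantile V_unif Y' K' VX'.
have S10 d0 (T0 : measurableType d0) (X0 : T -> T0) (K0 : R.-pker T0 ~> R) c :
    stop_loss P (cond_survival K0 X0 c) (1 - 0) = 0.
  by rewrite subr0; exact: S1.
have subKc (c : R) : 1 - (1 - c) = c by lra.
split=> H v v01; have [ES SL] := H v v01.
  have eq_sub (a b x y : R) : a = b -> x = 0 -> y = 0 -> b - x = a - y by
    move=> -> -> ->.
  have le_sub (a b x y : R) : a = b -> y <= x -> b - x <= a - y by move=> ->;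
    rewrite lerD2l lerN2.
  split; first by apply/(EFin_eqP (pE' _ _ v01 zero01) (pE _ _ v01 zero01));
    exact: eq_sub ES (S10 _ _ _ _ _) (S10 _ _ _ _ _).
  move=> t t01; rewrite (EFin_leE (pE' _ _ v01 t01) (pE _ _ v01 t01)).
  by apply: (le_sub _ _ _ _ ES); apply: SL; exact: sub01.
have eq_sub (a b x y : R) : x = 0 -> y = 0 -> b - x = a - y -> a = b.
  by move=> -> ->; rewrite !subr0.
have le_sub (a b x y x' y' : R) : a = b -> x = x' -> y = y' -> b - x <= a - y
  -> y' <= x'.
  by move=> -> -> ->; rewrite lerD2l lerN2.
have {}ES : \int[P]_w cond_survival K X (quantile (df Y) v) w =
    \int[P]_w cond_survival K' X' (quantile (df Y') v) w.
  move/(EFin_eqP (pE' _ _ v01 zero01) (pE _ _ v01 zero01)): ES.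
  exact: eq_sub (S10 _ _ _ _ _) (S10 _ _ _ _ _).
split; first exact: ES.
move=> c /sub01 c01'.
have le1 := EFin_le (pE' _ _ v01 c01') (pE _ _ v01 c01') (SL _ c01').
exact (le_sub _ _ _ _ _ _ ES (congr1 (stop_loss P _) (subKc c)) (congr1
  (stop_loss P _) (subKc c)) le1).
Qed.

Lemma rearranged_stop_loss d (T : measurableType d) (R : realType)
    (P : probability T R) (U : {RV P >-> R}) (U_unif : uniform01 U)
    (Y : {RV P >-> R}) p (X : {RV P >-> p.-tuple R})
    (K : R.-pker (p.-tuple R) ~> R)
    (Q : forall i : nat, R.-pker (i.-tuple R) ~> R) (F : R -> R -> R)
    (Q_rcd : sequential_cond_distributions P X Q)
    (F_rearr : rearranged_cond_df K Q F) v c :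
  stop_loss P (rearranged_survival Y F v \o U) c =
  stop_loss P (cond_survival K X (quantile (df Y) v)) c.
Proof.
apply: (rearranged_survival_law U_unif Y Q_rcd F_rearr v (f := fun x => Num.max
  (x - c) 0)).
  by apply: measurable_maxr => //; exact: measurable_funB.
by move=> x; rewrite le_max lexx orbT.
Qed.

Lemma ccx_le_rearranged d (T : measurableType d) (R : realType)
    (P : probability T R) (p p' : nat) (U V : {RV P >-> R})
    (U_unif : uniform01 U) (V_unif : uniform01 V)
    (Y : {RV P >-> R}) (X : {RV P >-> p.-tuple R})
    (Y' : {RV P >-> R}) (X' : {RV P >-> p'.-tuple R})
    (K : R.-pker (p.-tuple R) ~> R) (K' : R.-pker (p'.-tuple R) ~> R)
    (Q Q' : forall i : nat, R.-pker (i.-tuple R) ~> R) (F F' : R -> R -> R) :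
  independent_rv P V U ->
  sequential_cond_distributions P X Q -> sequential_cond_distributions P X' Q' ->
  rearranged_cond_df K Q F -> rearranged_cond_df K' Q' F' ->
  ccx_le Y X K Y' X' K' <->
  concordance_le P (fun w => (df Y (rearranged_quantile F (U w) (V w)), U w))
                   (fun w => (df Y' (rearranged_quantile F' (U w) (V w)), U w)).
Proof.
have mU : measurable_fun setT U := measurable_funP U.
move=> VU QX QX' KF KF'; rewrite ccx_leP (@concordance_uniformP _ _ _ _ _ _ _ _
  _ mU); first last.
- exact: U_unif.
- by move=> w; apply: cdf_itv01; exact: is_cdf_distribution.
- by move=> w; apply: cdf_itv01; exact: is_cdf_distribution.
- exact: measurable_rearranged KF'.
- exact: measurable_rearranged KF.
have SLE v : stop_loss_le P (cond_survival K X (quantile (df Y) v))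
      (cond_survival K' X' (quantile (df Y') v)) <->
    stop_loss_le P (rearranged_survival Y F v \o U) (rearranged_survival Y' F'
      v \o U).
  (* For nonnegative variables the mean is the stop-loss transform at 0, so [rearranged_stop_loss]
     transfers both the means and the inequalities. *)
  rewrite /stop_loss_le -!(@stop_loss0 _ _ _ P); first last.
  - by move=> w; case/andP: (cond_survival_itv01 K X (quantile (df Y) v) w).
  - by move=> w; case/andP: (cond_survival_itv01 K' X' (quantile (df Y') v) w).
  - by move=> w; case/andP: (rearranged_survival01 Y KF v (U w)).
  - by move=> w; case/andP: (rearranged_survival01 Y' KF' v (U w)).
  have e := rearranged_stop_loss U_unif Y QX KF v.
  have e' := rearranged_stop_loss U_unif Y' QX' KF' v.
  have leE (a b x y : R) : a = x -> b = y -> a <= b -> x <= y by move=> -> ->.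
  split=> -[E H]; split.
  - exact: etrans (e 0) (etrans E (esym (e' 0))).
  - by move=> c c01; exact: leE (esym (e c)) (esym (e' c)) (H c c01).
  - exact: etrans (esym (e 0)) (etrans E (e' 0)).
  - by move=> c c01; exact: leE (e c) (e' c) (H c c01).
have tailE v := stop_loss_tail U_unif
  (measurable_rearranged_survival U Y KF v) (rearranged_survival01 Y KF v)
  (rearranged_survival_nd Y KF v)
  (measurable_rearranged_survival U Y' KF' v) (rearranged_survival01 Y' KF' v)
  (rearranged_survival_nd Y' KF' v).
have tail0 v := tail_expectation0 U_unif (measurable_rearranged_survival U Y KF v)
  (rearranged_survival01 Y KF v).
have tail0' v := tail_expectation0 U_unif (measurable_rearranged_survival U Y'
  KF' v)
  (rearranged_survival01 Y' KF' v).
have pE v t v01 := @prob_rearranged _ _ _ _ U V U_unif V_unif Y _ _ _ _ VU KF v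
  t v01.
have pE' v t v01 := @prob_rearranged _ _ _ _ U V U_unif V_unif Y' _ _ _ _ VU
  KF' v t v01.
split=> H v v01.
  have /SLE/tailE[E L] := H v v01.
  split; last by move=> t t01; rewrite (EFin_leE (pE v t v01) (pE' v t v01));
    exact: L.
  apply/(EFin_eqP (pE v 0 v01) (pE' v 0 v01)).
  exact: etrans (tail0 v) (etrans E (esym (tail0' v))).
apply/SLE/tailE; have [E L] := H v v01; split.
  move/(EFin_eqP (pE v 0 v01) (pE' v 0 v01)): E => E.
  exact: etrans (esym (tail0 v)) (etrans E (tail0' v)).
by move=> t t01; have := L t t01; rewrite (EFin_leE (pE v t v01) (pE' v t v01)).
Qed.

Theorem theorem1p6 (R : realType) (d : measure_display) (T : measurableType d)
    (P : probability T R) (p p' : nat) (p_gt0 : (0 < p)%N) (p'_gt0 : (0 < p')%N)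
    (Y : {RV P >-> R}) (X : {RV P >-> p.-tuple R})
    (Y' : {RV P >-> R}) (X' : {RV P >-> p'.-tuple R})
    (U V : {RV P >-> R})
    (U_unif : uniform01 U) (V_unif : uniform01 V)
    (UV_indep : independent_rv P U V)
    (VX_indep : independent_rv P V X) (VX'_indep : independent_rv P V X')
    (K : R.-pker (p.-tuple R) ~> R) (K' : R.-pker (p'.-tuple R) ~> R)
    (K_rcd : regular_cond_distribution P Y X K)
    (K'_rcd : regular_cond_distribution P Y' X' K')
    (Q Q' : forall i : nat, R.-pker (i.-tuple R) ~> R)
    (Q_rcd : sequential_cond_distributions P X Q)
    (Q'_rcd : sequential_cond_distributions P X' Q')
    (F F' : R -> R -> R)
    (F_rearr : rearranged_cond_df K Q F)
    (F'_rearr : rearranged_cond_df K' Q' F') :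
  let Z w := (df Y (quantile (cond_df K (X w)) (V w)), V w) in
  let Z' w := (df Y' (quantile (cond_df K' (X' w)) (V w)), V w) in
  let W w := (df Y (rearranged_quantile F (U w) (V w)), U w) in
  let W' w := (df Y' (rearranged_quantile F' (U w) (V w)), U w) in
  [/\ ccx_le Y X K Y' X' K' <-> concordance_le P Z' Z,
      ccx_le Y X K Y' X' K' <-> concordance_le P W W',
      ccx_eq Y X K Y' X' K' <-> eq_distribution P Z Z' &
      ccx_eq Y X K Y' X' K' <-> eq_distribution P W W'].
Proof.
have VU_indep : independent_rv P V U.
  by move=> A B mA mB; rewrite setIC UV_indep// muleC.
move=> Z Z' W W'.
split.
- exact: ccx_le_conditional_quantile.
- exact: ccx_le_rearranged Q_rcd Q'_rcd F_rearr F'_rearr.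
- rewrite eq_distribution_concordance; first last.
  + exact: measurable_funP.
  + exact: measurable_conditional_quantile.
  + exact: measurable_conditional_quantile.
  rewrite /ccx_eq (ccx_le_conditional_quantile V_unif Y K Y' K' VX_indep VX'_indep).
  rewrite (ccx_le_conditional_quantile V_unif Y' K' Y K VX'_indep VX_indep).
  (* The first equivalence reverses the order, so the two directions come out swapped. *)
  by split=> -[].
- rewrite eq_distribution_concordance; first last.
  + exact: measurable_funP.
  + exact: measurable_rearranged F'_rearr.
  + exact: measurable_rearranged F_rearr.
  rewrite /ccx_eq (ccx_le_rearranged U_unif V_unif Y Y' VU_indep Q_rcd Q'_rcd
    F_rearr F'_rearr).
  by rewrite (ccx_le_rearranged U_unif V_unif Y' Y VU_indep Q'_rcd Q_rcd
    F'_rearr F_rearr).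
Qed.
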